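(* Assume condition (A1) (stated in the context) and let $D\subset\mathbb{R}^d$ be an open, bounded set. Let $f:D\to\mathbb{R}$ be continuous and let $u\in C_b(\mathbb{R}^d)$ be a viscosity subsolution to $$Lu=-f\ \text{ in }\{u>0\}\cap D,\qquad\text{and}\qquad u\le0\ \text{ in } D^c.$$ Then for every $p>\frac d2$ there exists a constant $C=C(d,p,\operatorname{diam}(D))$ satisfying $$\sup_D u\le C\,\|f^+\|_{L^p(D)}.$$
   Context: Operator: $j:\mathbb{R}^d\setminus\{0\}\to[0,\infty)$ is a jump kernel satisfying $\int_{\mathbb{R}^d}(1\wedge|y|^2)j(y)\,dy<\infty$, and $$Lu(x)=\Delta u(x)+\int_{\mathbb{R}^d}\big(u(x+y)-u(x)-\mathbf 1_{\{|y|\le1\}}\,y\cdot\nabla u(x)\big)j(y)\,dy.$$ Exponent and condition (A1): $\psi(z)=\int_{\mathbb{R}^d}(1-e^{iz\cdot\xi}+\mathbf 1_{\{|\xi|\le1\}}\,iz\cdot\xi)\,j(\xi)\,d\xi$. Condition (A1): for some constant $C_0>0$, $|\mathrm{Im}\,\psi(q)|\le C_0(|q|^2+|\mathrm{Re}\,\psi(q)|)$ for all $q\in\mathbb{R}^d$, and for all $r>0$, $\sup_{|q|\le r}(|q|^2+\mathrm{Re}\,\psi(q))>0$. Viscosity subsolutions: for an open set $G$, a bounded function $u:\mathbb{R}^d\to\mathbb{R}$, upper semicontinuous in $\bar G$, is a viscosity subsolution of $Lu=h$ in $G$ (written $Lu\ge h$) if for every $x\in G$, every neighbourhood $N_x$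 of $x$ in $G$ and every $\varphi\in C^2(\overline{N_x})$ such that $\varphi-u$ attains minimum $0$ in $N_x$ at $x$, the function $v$ equal to $\varphi$ in $N_x$ and to $u$ elsewhere satisfies $Lv(x)\ge h(x)$. Here $G=\{u>0\}\cap D$ and $h=-f$. $C_b(\mathbb{R}^d)$ denotes the bounded continuous functions on $\mathbb{R}^d$; $f^+=\max(f,0)$; $D^c=\mathbb{R}^d\setminus D$.
   Formalization: The exponent is required to satisfy p ≥ 1 as well as p > d/2; this excludes only d = 1, 1/2 < p < 1, where the estimate fails (j = 0, D = (-1,1), f a bump of height n and width 1/n: the L^p norm tends to 0 while sup u does not). *)

(* Defs.v *)
From HB Require Import structures.
From mathcomp Require Import all_boot all_order all_algebra.
From mathcomp Require Import complex.
From mathcomp Require Import all_classical all_reals all_analysis.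

Set Implicit Arguments.
Unset Strict Implicit.
Unset Printing Implicit Defensive.
Import Order.TTheory GRing.Theory Num.Theory.
Import numFieldNormedType.Exports.
Local Open Scope classical_set_scope.
Local Open Scope ring_scope.

(* The sigma-algebra on R^d generated by the coordinate maps (the product
   sigma-algebra, which is also the Borel one). *)

Fact measure_rV_display : measure_display.
Proof. exact: default_measure_display. Qed.

Section measurable_rV.
Context {R : realType} (d : nat).

Let coord (i : 'I_d) (x : 'rV[R]_d) : measurableTypeR R := x 0 i.

Let rV_set0 : g_sigma_preimage coord set0.
Proof. exact: sigma_algebra0. Qed.

Let rV_setC A : g_sigma_preimage coord A -> g_sigma_preimage coord (~` A).
Proof. exact: sigma_algebraC. Qed.

Let rV_bigcup (F : (set 'rV[R]_d)^nat) :
  (forall i, g_sigma_preimage coord (F i)) ->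
  g_sigma_preimage coord (\bigcup_i (F i)).
Proof. exact: sigma_algebra_bigcup. Qed.

HB.instance Definition _ := @isMeasurable.Build measure_rV_display
  'rV[R]_d (g_sigma_preimage coord) rV_set0 rV_setC rV_bigcup.

Lemma measurable_coord (i : 'I_d) :
  measurable_fun [set: 'rV[R]_d] (fun x : 'rV[R]_d => x 0 i : measurableTypeR R).
Proof.
move=> _ Y mY; rewrite setTI; apply: sub_sigma_algebra => /=.
rewrite -bigcup_seq/=; exists i => /=; first by rewrite mem_index_enum.
by exists Y => //; rewrite setTI.
Qed.

Lemma measurable_fun_rVP d1 (T1 : measurableType d1) (f : T1 -> 'rV[R]_d) :
  (forall i, measurable_fun [set: T1] (fun x => f x 0 i : measurableTypeR R)) ->
  measurable_fun [set: T1] f.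
Proof.
move=> mf _ A mA; rewrite setTI.
suff : (g_sigma_preimage coord) `<=` [set B | measurable (f @^-1` B)] by exact.
apply: smallest_sub; first split => /=.
- by rewrite preimage_set0.
- by move=> B mB; rewrite setTD preimage_setC; exact: measurableC.
- by move=> F mF; rewrite preimage_bigcup; exact: bigcup_measurable.
- rewrite -bigcup_seq; apply: bigcup_sub => i _ _ [Y mY <-] /=.
  by have := mf i measurableT Y mY; rewrite !setTI.
Qed.

End measurable_rV.

(* Lebesgue measure on R^d, by induction on d: the image of the product measure
   of R * R^d under (a, x) |-> (a, x_0, ..., x_(d-1)). *)

Section lebesgue_rV.
Context {R : realType}.

Definition cons_rV d (p : measurableTypeR R * 'rV[R]_d) : 'rV[R]_d.+1 :=
  \row_i oapp (p.2 0) p.1 (unlift ord0 i).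

Lemma measurable_cons_rV d : measurable_fun [set: _] (@cons_rV d).
Proof.
apply: measurable_fun_rVP => i; under eq_fun do rewrite mxE.
case: unliftP => [k _|_] /=; last exact: measurable_fst.
exact: measurableT_comp (measurable_coord k) measurable_snd.
Qed.

Section step.
Variables (d : nat) (mu : {sigma_finite_measure set 'rV[R]_d -> \bar R}).

Definition lebesgue_rVS : set 'rV[R]_d.+1 -> \bar R :=
  pushforward (lebesgue_measure \x mu)%E (@cons_rV d).

Let lebesgue_rVS0 : lebesgue_rVS set0 = 0%E.
Proof. by rewrite /lebesgue_rVS /pushforward preimage_set0 measure0. Qed.

Let lebesgue_rVS_ge0 A : (0 <= lebesgue_rVS A)%E.
Proof. by rewrite /lebesgue_rVS /pushforward measure_ge0. Qed.

Let lebesgue_rVS_sigma_additive : semi_sigma_additive lebesgue_rVS.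
Proof.
move=> F mF tF mUF; rewrite /lebesgue_rVS /pushforward preimage_bigcup.
have mpre (A : set 'rV[R]_d.+1) : measurable A ->
    measurable (@cons_rV d @^-1` A).
  by move=> mA; rewrite -[X in measurable X]setTI; exact: measurable_cons_rV.
apply: measure_semi_sigma_additive.
- by move=> n; exact: mpre.
- apply/trivIsetP => /= i j _ _ ij; rewrite -preimage_setI.
  by move/trivIsetP : tF => /(_ _ _ _ _ ij) ->//; rewrite preimage_set0.
- by rewrite -preimage_bigcup; exact: mpre.
Qed.

HB.instance Definition _ := isMeasure.Build _ _ _ lebesgue_rVS
  lebesgue_rVS0 lebesgue_rVS_ge0 lebesgue_rVS_sigma_additive.

Let uncons_rV (x : 'rV[R]_d.+1) : measurableTypeR R * 'rV[R]_d :=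
  (x 0 0, \row_(i < d) x 0 (lift ord0 i)).

Let cons_rVK : cancel (@cons_rV d) uncons_rV.
Proof.
move=> [a x]; rewrite /uncons_rV /cons_rV; congr pair => /=.
  by rewrite mxE unlift_none.
by apply/rowP => i; rewrite !mxE liftK.
Qed.

Let measurable_uncons_rV : measurable_fun [set: _] uncons_rV.
Proof.
apply: measurable_fun_pair; first exact: measurable_coord.
apply: measurable_fun_rVP => i.
under eq_fun do rewrite mxE.
exact: measurable_coord.
Qed.

Let lebesgue_rVS_sigma_finite : sigma_finite setT lebesgue_rVS.
Proof.
have /sigma_finiteP[F [TF ndF Foo]] :=
  sigma_finiteT (@lebesgue_measure R : {sigma_finite_measure set _ -> \bar R}).
have /sigma_finiteP[G [TG ndG Goo]] := sigma_finiteT mu.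
exists (fun n => uncons_rV @^-1` (F n `*` G n)).
  rewrite -preimage_bigcup (_ : \bigcup_n _ = setT) ?preimage_setT//.
  rewrite -setXTT TF TG predeqE => -[x y]; split.
    by move=> [n _ []/= ? ?]; split; exists n.
  move=> [/= [n _ Fnx] [k _ Gky]]; exists (maxn n k) => //; split.
  - by move: x Fnx; exact/subsetPset/ndF/leq_maxl.
  - by move: y Gky; exact/subsetPset/ndG/leq_maxr.
move=> n; have [mF ltF] := Foo n; have [mG ltG] := Goo n.
split.
  rewrite -[X in measurable X]setTI; apply: measurable_uncons_rV => //.
  exact: measurableX.
rewrite /lebesgue_rVS /pushforward -comp_preimage.
rewrite (_ : uncons_rV \o _ = id) ?preimage_id; last exact/funext/cons_rVK.
by rewrite product_measure1E// lte_mul_pinfty// ge0_fin_numE.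
Qed.

HB.instance Definition _ := Measure_isSigmaFinite.Build _ _ _ lebesgue_rVS
  lebesgue_rVS_sigma_finite.

End step.

Fixpoint lebesgue_rV d : {sigma_finite_measure set 'rV[R]_d -> \bar R} :=
  match d with
  | 0 => dirac (0 : 'rV[R]_0)
  | d'.+1 => lebesgue_rVS (lebesgue_rV d')
  end.

End lebesgue_rV.

Lemma lebesgue_rV_box (R : realType) d (A : 'I_d -> set (measurableTypeR R)) :
  (forall i, measurable (A i)) ->
  lebesgue_rV d [set x : 'rV[R]_d | forall i, A i (x 0 i)] =
  (\prod_(i < d) lebesgue_measure (A i))%E.
Proof.
elim: d A => [|d IH] A mA.
  rewrite big_ord0 /= diracE mem_set//= => -[].
  by [].
rewrite big_ord_recl /= /lebesgue_rVS /pushforward.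
rewrite (_ : _ @^-1` _ =
    A ord0 `*` [set x : 'rV[R]_d | forall i, A (lift ord0 i) (x 0 i)]).
  rewrite product_measure1E//; first by rewrite (IH (fun i => A (lift ord0 i))).
  rewrite (_ : [set x | _] =
    \bigcap_(i in [set: 'I_d]) ((fun x : 'rV[R]_d => x 0 i) @^-1` A (lift ord0 i))).
    apply: fin_bigcap_measurable => // i _.
    by rewrite -[X in measurable X]setTI; exact: measurable_coord.
  by apply/seteqP; split => [x Ax i _|x Ax i]; [exact: Ax|exact: (Ax i I)].
apply/seteqP; split => [[a x] /= Ax|[a x] /= [Aa Ax] i].
  split; first by have := Ax ord0; rewrite mxE unlift_none.
  by move=> i; have := Ax (lift ord0 i); rewrite mxE liftK.
by rewrite mxE; case: unliftP => [k ->|->].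
Qed.

Section euclidean.
Context {R : realType} {d : nat}.
Implicit Types (x y : 'rV[R]_d) (u : 'rV[R]_d -> R).

Definition dot x y : R := \sum_(i < d) x 0 i * y 0 i.

(* The norm `| x | of the library on 'rV[R]_d is the sup norm. *)
Definition enorm x : R := Num.sqrt (dot x x).

Definition diam (D : set 'rV[R]_d) : R := sup [set enorm (x - y) | x in D & y in D].

Definition partial (i : 'I_d) u x : R := 'D_(delta_mx 0 i) u x.

Definition grad u x : 'rV[R]_d := \row_i partial i u x.

Definition laplacian u x : R := \sum_(i < d) partial i (partial i u) x.

(* C^2 up to the boundary, for open N: phi and its partial derivatives of order
   at most 2 extend continuously from N to its closure. *)
Definition C2_closure (N : set 'rV[R]_d) (phi : 'rV[R]_d -> R) : Prop :=
  [/\ {within closure N, continuous phi},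
      forall i, (forall x, N x -> derivable phi x (delta_mx 0 i)) /\
        exists2 g : 'rV[R]_d -> R, {within closure N, continuous g} &
          {in N, partial i phi =1 g}
    & forall i k,
        (forall x, N x -> derivable (partial i phi) x (delta_mx 0 k)) /\
        exists2 g : 'rV[R]_d -> R, {within closure N, continuous g} &
          {in N, partial k (partial i phi) =1 g}].

Definition punctured : set 'rV[R]_d := [set y | y != 0].

Definition upper_semicontinuous_in (A : set 'rV[R]_d) u : Prop :=
  forall x, A x -> forall a, u x < a -> \forall y \near within A (nbhs x), u y < a.

End euclidean.

Section jump_operator.
Context {R : realType} {d : nat}.
Local Notation mu := (@lebesgue_rV R d).
Implicit Types (x y z q xi : 'rV[R]_d) (u v h phi : 'rV[R]_d -> R).
Implicit Types (G N : set 'rV[R]_d).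

(* The value of j at the origin is never used. *)
Definition jump_kernel (j : 'rV[R]_d -> R) : Prop :=
  [/\ measurable_fun punctured j,
      forall y, y != 0 -> 0 <= j y
    & (\int[mu]_(y in punctured) (Num.min 1 (enorm y ^+ 2) * j y)%:E < +oo)%E].

Variable j : 'rV[R]_d -> R.

Definition jump_op u x : R :=
  laplacian u x +
  \int[mu]_(y in punctured)
    ((u (x + y) - u x - (if enorm y <= 1 then dot y (grad u x) else 0)) * j y).

Definition cis (t : R) : R[i] := (cos t +i* sin t)%C.

Definition complex_integral (A : set 'rV[R]_d) (F : 'rV[R]_d -> R[i]) : R[i] :=
  ((\int[mu]_(xi in A) complex.Re (F xi)) +i*
   (\int[mu]_(xi in A) complex.Im (F xi)))%C.

Definition char_exponent z : R[i] :=
  complex_integral punctured (fun xi =>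
    (1 - cis (dot z xi) +
     (if enorm xi <= 1 then 'i * (dot z xi)%:C else 0)) * (j xi)%:C)%C.

Definition condition_A1 : Prop :=
  (exists2 C0 : R, 0 < C0 & forall q,
     `|complex.Im (char_exponent q)| <=
     C0 * (enorm q ^+ 2 + `|complex.Re (char_exponent q)|)) /\
  (forall r : R, 0 < r ->
     (0 < ereal_sup [set (enorm q ^+ 2 + complex.Re (char_exponent q))%:E
                    | q in [set q | (enorm q <= r)%R]])%E).

(* [jump_op j u >= h in G]; neighbourhoods are taken open, so that being C^2 up
   to the closure makes sense and the patched function is measurable. *)
Definition viscosity_subsolution G u h : Prop :=
  [/\ bounded_fun u,
      upper_semicontinuous_in (closure G) u
    & forall x N phi, G x -> open N -> N x -> N `<=` G ->
        C2_closure N phi ->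
        phi x = u x -> (forall y, N y -> u y <= phi y) ->
        h x <= jump_op (patch u N phi) x].

End jump_operator.

(* Main.v *)
Require Import Defs.
From HB Require Import structures.
From mathcomp Require Import all_boot all_order all_algebra.
From mathcomp Require Import complex.
From mathcomp Require Import all_classical all_reals all_analysis.
From mathcomp Require Import measurable_realfun ring lra.

(* Only two features of L are used: it is the sum of the Laplacian and of an
   operator that commutes with translations and satisfies the maximum principle.
   Let N be one Euler step of length h for the jump part (small jumps removed,
   compensating drift replaced by a rare small jump): a convex combination of
   averages of translates. If v solves the heat equation with v(0) = g, then
   w = h sum_k N^k v(kh), summed over kh < T, satisfies L w <= sup v(T) - g up to
   an error that vanishes in the limit, by telescoping, and
   sup w <= h sum_k sup v(kh) because N is an average. So all estimates reduce to
   the decay of the Gaussian kernel: sup v(t) <= C t^(-d/2p) |g|_p, integrable at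
   0 as p > d/2. Taking g = f^+ + M on D, with T so large, depending on diam D
   only, that the part of v(T) coming from M is at most M/2, and M twice the part
   of sup v(T) coming from f^+, makes w a supersolution in D, and the comparison
   of u with the smooth function w is immediate from the definition of viscosity
   subsolution. *)

Set Implicit Arguments.
Unset Strict Implicit.
Unset Printing Implicit Defensive.
Import Order.TTheory GRing.Theory Num.Theory.
Import numFieldNormedType.Exports.
Local Open Scope classical_set_scope.
Local Open Scope ring_scope.

(** * Expansions and the heat kernel *)

(** The kernel [j] is arbitrary, so neither a semigroup of L nor a regularity theory for L is at
    hand, while test functions must be C^2. Smoothness therefore comes from the heat kernel alone,
    in the form of expansions with uniform constants, and all nonlocal constructions are averages
    that preserve such expansions. To keep the constants uniform down to t = 0, the heat flow starts
    from a kernel of age s > 0: v(t) is the kernel at time s + t integrated against g over D. The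
    price is that v(0) is close to g only at points that have a ball inside D on which g does not
    drop much. The comparison hence takes place on the compact set {u >= e}, which lies in D, and
    [f], possibly unbounded near the boundary of D, is truncated at the maximum of its positive part
    there. Every loss is a multiple of e, and e tends to 0 at the very end. The time T comes from
    the peak of the kernel: M on D contributes at most M |D| (4 pi T)^(-d/2) to v(T), and |D| is at
    most (2 diam D)^d. *)

Section jets.
Context {R : realType}.
Implicit Types A B r a b alpha beta : R.

(* [a] and [a'] are the values of a function at two points at distance [r], and
   [alpha] is the differential of the function applied to the displacement. *)
Definition jet A r a a' alpha :=
  [/\ `|a| <= A, `|a'| <= A, `|a' - a| <= A * r, `|alpha| <= A * r &
      `|a' - a - alpha| <= A * r ^+ 2].

Lemma jet_le A B r a a' alpha : 0 <= r -> A <= B ->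
  jet A r a a' alpha -> jet B r a a' alpha.
Proof.
move=> r0 AB [h1 h2 h3 h4 h5]; split.
- exact: le_trans AB.
- exact: le_trans AB.
- by apply: le_trans h3 _; exact: ler_wpM2r.
- by apply: le_trans h4 _; exact: ler_wpM2r.
- by apply: le_trans h5 _; apply: ler_wpM2r => //; exact: exprn_ge0.
Qed.

(** The error of the Leibniz rule is a' (b' - b - beta) + (a' - a) beta + b (a' - a - alpha): three
    terms of size A B r^2, whence the factor 3. *)
Lemma jetM A B r a a' alpha b b' beta : 0 <= r ->
  jet A r a a' alpha -> jet B r b b' beta ->
  jet (3 * A * B) r (a * b) (a' * b') (a * beta + alpha * b).
Proof.
move=> r0 [ha1 ha2 ha3 ha4 ha5] [hb1 hb2 hb3 hb4 hb5].
have A0 : 0 <= A by exact: le_trans ha1.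
have B0 : 0 <= B by exact: le_trans hb1.
have AB0 : 0 <= A * B by exact: mulr_ge0.
have ABr0 : 0 <= A * B * r by exact: mulr_ge0.
have ABrr0 : 0 <= A * B * r ^+ 2 by rewrite mulr_ge0// exprn_ge0.
have e1 : `|a * b| <= A * B by rewrite normrM ler_pM.
have e2 : `|a' * b'| <= A * B by rewrite normrM ler_pM.
have e3 : `|a' * (b' - b)| <= A * (B * r) by rewrite normrM ler_pM.
have e4 : `|(a' - a) * b| <= A * r * B by rewrite normrM ler_pM.
have e5 : `|a * beta| <= A * (B * r) by rewrite normrM ler_pM.
have e6 : `|alpha * b| <= A * r * B by rewrite normrM ler_pM.
have e7 : `|a' * (b' - b - beta)| <= A * (B * r ^+ 2) by rewrite normrM ler_pM.
have e8 : `|(a' - a) * beta| <= A * r * (B * r) by rewrite normrM ler_pM.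
have e9 : `|b * (a' - a - alpha)| <= B * (A * r ^+ 2) by rewrite normrM ler_pM.
split.
- by apply: le_trans e1 _; nra.
- by apply: le_trans e2 _; nra.
- have -> : a' * b' - a * b = a' * (b' - b) + (a' - a) * b by ring.
  by apply: le_trans (ler_normD _ _) _; nra.
- by apply: le_trans (ler_normD _ _) _; nra.
- have -> : a' * b' - a * b - (a * beta + alpha * b) =
    a' * (b' - b - beta) + (a' - a) * beta + b * (a' - a - alpha) by ring.
  apply: le_trans (ler_normD _ _) _; apply: le_trans (lerD (ler_normD _ _) (lexx _)) _.
  by nra.
Qed.

Lemma jet_prod A r n (a a' alpha : 'I_n -> R) : 0 <= r -> 1 <= A ->
  (forall i, jet A r (a i) (a' i) (alpha i)) ->
  jet ((3 * A) ^+ n) r (\prod_i a i) (\prod_i a' i)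
    (\sum_i \prod_j (if j == i then alpha j else a j)).
Proof.
move=> r0 A1; elim: n a a' alpha => [|n IH] a a' alpha h.
  rewrite /jet !big_ord0 expr0 subrr subr0 !mul1r normr0 normr1; split => //.
  exact: exprn_ge0.
rewrite !big_ord_recl/= exprS.
have := jetM r0 (h ord0) (IH _ _ _ (fun i => h (lift ord0 i))).
congr jet; rewrite addrC; congr (_ + _).
rewrite mulr_sumr; apply: eq_bigr => i _.
by rewrite [RHS]big_ord_recl.
Qed.

(** The mean value theorem, used for [f] and then for [f1], writes the remainder as a value of [f2]
    times two lengths of at most y - x. Both orientations are given because a displacement may have
    either sign. *)
Lemma jet_derive (f f1 f2 : R -> R) A (x y : R) : 0 <= A -> x <= y ->
  (forall z, x <= z <= y -> is_derive z 1 f (f1 z)) ->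
  (forall z, x <= z <= y -> is_derive z 1 f1 (f2 z)) ->
  (forall z, x <= z <= y -> [/\ `|f z| <= A, `|f1 z| <= A & `|f2 z| <= A]) ->
  jet A `|y - x| (f x) (f y) ((y - x) * f1 x) /\
  jet A `|x - y| (f y) (f x) ((x - y) * f1 y).
Proof.
move=> A0 xy d1 d2 bd.
have itvW a b : x <= a -> b <= y -> forall z, z \in `]a, b[ -> x <= z <= y.
  move=> xa b_y z; rewrite in_itv/= => /andP[/ltW az /ltW zb].
  by rewrite (le_trans xa az) (le_trans zb b_y).
have itvC a b : x <= a -> b <= y -> forall z, z \in `[a, b] -> x <= z <= y.
  move=> xa b_y z; rewrite in_itv/= => /andP[az zb].
  by rewrite (le_trans xa az) (le_trans zb b_y).
have mvt (g g1 : R -> R) a b : x <= a -> a <= b -> b <= y ->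
    (forall z, x <= z <= y -> is_derive z 1 g (g1 z)) ->
    exists2 c, (a <= c <= b) & g b - g a = g1 c * (b - a).
  move=> xa ab b_y dg.
  have [||c] := @MVT_segment R g g1 a b ab.
  - by move=> z /(itvW _ _ xa b_y); exact: dg.
  - apply: derivable_within_continuous => z /(itvC _ _ xa b_y) zxy.
    by have [] := dg _ zxy.
  - by rewrite in_itv/= => ? ?; exists c.
have yx0 : 0 <= y - x by rewrite subr_ge0.
have xx : x <= x <= y by rewrite lexx.
have yy : x <= y <= y by rewrite lexx xy.
have [c /andP[xc cy] fc] := mvt f f1 x y (lexx _) xy (lexx _) d1.
have cxy : x <= c <= y by rewrite xc.
have [e /andP[xe ec] f1e] := mvt f1 f2 x c (lexx _) xc cy d2.
have exy : x <= e <= y by rewrite xe (le_trans ec).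
have [k /andP[ck ky] f1k] := mvt f1 f2 c y xc cy (lexx _) d2.
have kxy : x <= k <= y by rewrite (le_trans xc ck).
have [bx1 bx2 bx3] := bd _ xx; have [by1 by2 by3] := bd _ yy.
have [bc1 bc2 bc3] := bd _ cxy; have [be1 be2 be3] := bd _ exy.
have [bk1 bk2 bk3] := bd _ kxy.
split; split => //.
- by rewrite fc normrM ler_wpM2r.
- by rewrite mulrC normrM ler_wpM2r.
- have -> : f y - f x - (y - x) * f1 x = f2 e * (c - x) * (y - x).
    by rewrite fc -f1e; ring.
  rewrite !normrM expr2 mulrA ler_pM// ?mulr_ge0// ler_pM//.
  by rewrite !ger0_norm ?subr_ge0// lerB.
- by rewrite -opprB fc normrN normrM distrC ler_wpM2r.
- by rewrite mulrC normrM ler_wpM2r.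
- have -> : f x - f y - (x - y) * f1 y = f2 k * (y - c) * (y - x).
    have -> : f x - f y = - (f1 c * (y - x)) by rewrite -fc opprB.
    by rewrite -f1k; ring.
  rewrite distrC !normrM expr2 mulrA ler_pM// ?mulr_ge0// ler_pM//.
  by rewrite !ger0_norm ?subr_ge0// lerB.
Qed.
End jets.

(** * The one-dimensional Gaussian and its derivatives *)

Section gauss.
Context {R : realType}.
Implicit Types t z q : R.

(* The factor [t^(-1/2)] is written with [ln] so that the exponent
   carries the whole dependence on [t]. *)
Definition gauss t z : R :=
  (Num.sqrt (4 * pi))^-1 * expR (- (z ^+ 2 / (4 * t)) - ln t / 2).

(* [herm m (2t)^-1 z] is the factor in the [m]-th derivative of [gauss t] at [z]
   for [m <= 4]; higher orders are not needed and get the junk value 0. *)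
Definition herm (m : nat) q z : R :=
  match m with
  | 0 => 1
  | 1 => - (q * z)
  | 2 => q ^+ 2 * z ^+ 2 - q
  | 3 => - (q ^+ 3 * z ^+ 3) + 3 * q ^+ 2 * z
  | 4 => q ^+ 4 * z ^+ 4 - 6 * q ^+ 3 * z ^+ 2 + 3 * q ^+ 2
  | _ => 0
  end.

Definition dgauss m t z := herm m (2 * t)^-1 z * gauss t z.

Lemma gauss_gt0 t z : 0 < gauss t z.
Proof.
by rewrite mulr_gt0 ?expR_gt0// invr_gt0 sqrtr_gt0 mulr_gt0// pi_gt0.
Qed.

Lemma is_derive_gauss t z : 0 < t ->
  is_derive z 1 (gauss t) (- ((2 * t)^-1 * z) * gauss t z).
Proof.
move=> t0; rewrite /gauss.
have h : is_derive z (1:R) (fun z => - (z ^+ 2 / (4 * t)) - ln t / 2)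
    (- ((2 * t)^-1 * z)).
  apply: is_derive_eq.
  by rewrite /GRing.scale/=; field; rewrite gt_eqF.
have h2 := is_derive1_comp (is_derive_expR _) h.
apply: is_derive_eq.
by rewrite /GRing.scale/=; ring.
Qed.

(** This is the heat equation in dimension one, since [dgauss 2] is also the second derivative in
    z. *)
Lemma is_derive_gausst t z : 0 < t ->
  is_derive t 1 (gauss^~ z) (dgauss 2 t z).
Proof.
move=> t0; rewrite /gauss.
have ht := is_derive1_ln t0.
have tn0 : t != 0 by rewrite gt_eqF.
have h0 : is_derive t (1:R) (fun t => (4 * t)^-1) (- (4 * t) ^- 2 * 4).
  have h4 : 4 * t != 0 by rewrite mulf_neq0.
  apply: is_derive_eq.
  by rewrite /GRing.scale/=; field.
have h : is_derive t (1:R) (fun t => - (z ^+ 2 * (4 * t)^-1) - ln t / 2)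
    ((2 * t)^-1 ^+ 2 * z ^+ 2 - (2 * t)^-1).
  apply: is_derive_eq.
  by rewrite /GRing.scale/=; field.
have h2 := is_derive1_comp (is_derive_expR _) h.
apply: is_derive_eq.
by rewrite /dgauss /gauss /GRing.scale/=; ring.
Qed.

Lemma is_derive_dgauss m t z : 0 < t -> (m < 4)%N ->
  is_derive z 1 (dgauss m t) (dgauss m.+1 t z).
Proof.
move=> t0 m4; have hg := is_derive_gauss z t0; rewrite /dgauss.
set q := (2 * t)^-1 in hg *.
have hz : is_derive z (1:R) id 1 by exact: is_derive_id.
have h : is_derive z (1:R) (herm m q) (herm m.+1 q z + q * z * herm m q z).
  case: m m4 => [|[|[|[|//]]]] _; rewrite /herm/=.
  - by apply: is_derive_eq; ring.
  - by apply: is_derive_eq; rewrite /GRing.scale/=; ring.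
  - by apply: is_derive_eq; rewrite /GRing.scale/=; ring.
  - by apply: is_derive_eq; rewrite /GRing.scale/=; ring.
by apply: is_derive_eq; rewrite /GRing.scale/=; ring.
Qed.

(** The heat equation once more: the second time derivative, which controls the remainder of a time
    step, is the fourth space derivative. *)
Lemma is_derive_dgausst t z : 0 < t ->
  is_derive t 1 (fun t => dgauss 2 t z) (dgauss 4 t z).
Proof.
move=> t0; have hg := is_derive_gausst z t0.
rewrite /dgauss/=.
have tn0 : t != 0 by rewrite gt_eqF.
have h0 : is_derive t (1:R) (fun t => (2 * t)^-1) (- (2 * t) ^- 2 * 2).
  have h4 : 2 * t != 0 by rewrite mulf_neq0.
  apply: is_derive_eq.
  by rewrite /GRing.scale/=; field.
apply: is_derive_eq.
rewrite /GRing.scale/= /dgauss/=.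
by field.
Qed.

Lemma gauss_le s t z : 0 < s -> s <= t ->
  gauss t z <= (Num.sqrt (4 * pi))^-1 * expR (- ln s / 2) *
    expR (- ((2 * t)^-1 * z ^+ 2) / 2).
Proof.
move=> s0 st; have t0 := lt_le_trans s0 st.
rewrite /gauss -mulrA ler_wpM2l ?invr_ge0 ?sqrtr_ge0//.
rewrite -expRD ler_expR.
have -> : z ^+ 2 / (4 * t) = (2 * t)^-1 * z ^+ 2 / 2 by field; rewrite gt_eqF.
have : ln s <= ln t by rewrite ler_ln// posrE.
by lra.
Qed.

(** All terms are polynomials in q, u = q z^2 and v = |q z|, where v^2 = q u. As q is bounded for t
    >= s, only a polynomial in u remains, which the Gaussian factor exp(-u/2) absorbs uniformly in
    t. *)
Lemma herm_le m q z : 0 <= q ->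
  `|herm m q z| <= 6 * (1 + q) ^+ 2 * (1 + q * z ^+ 2) ^+ 2.
Proof.
move=> q0; set u := q * z ^+ 2; set v := `|q * z|.
have u0 : 0 <= u by rewrite mulr_ge0// sqr_ge0.
have v0 : 0 <= v by exact: normr_ge0.
have vE : v ^+ 2 = q * u by rewrite /v real_normK ?num_real// exprMn /u; ring.
have vle : v <= (1 + q) * (1 + u).
  rewrite -(@ler_pXn2r _ 2)// ?nnegrE// ?mulr_ge0 ?addr_ge0// vE; nra.
set a := 1 + q in vle *; set b := 1 + u in vle *.
have a1 : 1 <= a by rewrite lerDl.
have b1 : 1 <= b by rewrite lerDl.
have ab1 : 1 <= a * b by nra.
have -> : 6 * a ^+ 2 * b ^+ 2 = 6 * (a * b) ^+ 2 by ring.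
have sq : a * b <= (a * b) ^+ 2 by rewrite expr2 ler_peMl// (le_trans ler01).
have qab : q <= a * b by rewrite /a /b; nra.
have uab : u <= a * b by rewrite /a /b; nra.
have quab : q * u <= a * b by rewrite /a /b; nra.
have qu0 : 0 <= q * u by exact: mulr_ge0.
case: m => [|[|[|[|[|m]]]]] /=.
- by rewrite normr1; lra.
- by rewrite normrN -/v; lra.
- have -> : q ^+ 2 * z ^+ 2 - q = q * u - q by rewrite /u; ring.
  by rewrite (le_trans (ler_normB _ _))// !ger0_norm//; lra.
- have -> : - (q ^+ 3 * z ^+ 3) + 3 * q ^+ 2 * z = (q * z) * (3 * q - q * u).
    by rewrite /u; ring.
  rewrite normrM -/v.
  apply: (@le_trans _ _ ((a * b) * (4 * (a * b)))); last by nra.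
  rewrite ler_pM// (le_trans (ler_normB _ _))// !ger0_norm//; nra.
- have -> : q ^+ 4 * z ^+ 4 - 6 * q ^+ 3 * z ^+ 2 + 3 * q ^+ 2 =
    (q * u) ^+ 2 - 6 * (q * (q * u)) + 3 * q ^+ 2 by rewrite /u; ring.
  have h1 : (q * u) ^+ 2 - 6 * (q * (q * u)) + 3 * q ^+ 2 =
    q ^+ 2 * (u ^+ 2 - 6 * u + 3) by ring.
  have h2 : `|u ^+ 2 - 6 * u + 3| <= 6 * b ^+ 2.
    by rewrite ler_norml /b; apply/andP; split; nra.
  have h3 : `|q ^+ 2| <= a ^+ 2 by rewrite ger0_norm ?sqr_ge0// /a; nra.
  rewrite h1 normrM; have -> : 6 * (a * b) ^+ 2 = a ^+ 2 * (6 * b ^+ 2) by ring.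
  exact: ler_pM.
- by rewrite normr0 mulr_ge0 ?sqr_ge0.
Qed.

Lemma dgauss_bound s : 0 < s ->
  exists2 A, 1 <= A & forall m t z, s <= t -> `|dgauss m t z| <= A.
Proof.
move=> s0; pose c := (Num.sqrt (4 * pi))^-1 * expR (- ln s / 2) : R.
pose Q := (2 * s)^-1; have Q0 : 0 <= Q by rewrite invr_ge0 mulr_ge0// ltW.
have c0 : 0 <= c by rewrite mulr_ge0// ?expR_ge0// invr_ge0 sqrtr_ge0.
exists (1 + 6 * (1 + Q) ^+ 2 * 16 * c).
  by rewrite lerDl !mulr_ge0// addr_ge0.
move=> m t z st; have t0 := lt_le_trans s0 st.
have q0 : 0 <= (2 * t)^-1 by rewrite invr_ge0 mulr_ge0// ltW.
have qQ : (2 * t)^-1 <= Q by rewrite lef_pV2 ?posrE ?mulr_gt0// ler_wpM2l.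
rewrite /dgauss normrM [X in _ * X]gtr0_norm ?gauss_gt0//.
apply: le_trans (ler_pM _ _ (herm_le _ _ q0) (gauss_le _ s0 st)) _ => //.
  exact/ltW/gauss_gt0.
rewrite -/c; set q := (2 * t)^-1 in q0 qQ *; set u := q * z ^+ 2.
have u0 : 0 <= u by rewrite mulr_ge0// sqr_ge0.
(* 1 + u <= 4 (1 + u/4) <= 4 exp(u/4), squared. *)
have hb : (1 + u) ^+ 2 * expR (- u / 2) <= 16.
  have h : 1 + u / 4 <= expR (u / 4) by exact: expR_ge1Dx.
  have -> : - u / 2 = - (u / 4 + u / 4) by field.
  rewrite expRN expRD -expr2 ler_pdivrMr ?exprn_gt0 ?expR_gt0//.
  have -> : 16 = 4 ^+ 2 :> R by ring.
  rewrite -exprMn ler_pXn2r ?nnegrE ?mulr_ge0 ?expR_ge0 ?addr_ge0//; lra.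
have ha : (1 + q) ^+ 2 <= (1 + Q) ^+ 2 by rewrite ler_pXn2r ?nnegrE ?addr_ge0// lerD2l.
have -> : 6 * (1 + q) ^+ 2 * (1 + u) ^+ 2 * (c * expR (- u / 2)) =
  6 * (1 + q) ^+ 2 * ((1 + u) ^+ 2 * expR (- u / 2)) * c by ring.
apply: (@le_trans _ _ (6 * (1 + Q) ^+ 2 * 16 * c)); last by rewrite lerDr.
rewrite ler_wpM2r//; apply: ler_pM => //; last by lra.
  by rewrite mulr_ge0// sqr_ge0.
by rewrite mulr_ge0 ?sqr_ge0 ?expR_ge0.
Qed.

(** An expansion of order two involves the derivatives up to order m + 2, and [herm] is meaningful
    up to order 4: hence m <= 2. *)
Lemma jet_dgauss s : 0 < s -> exists2 A, 1 <= A &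
  (forall m t x y, (m <= 2)%N -> s <= t ->
    jet A `|y| (dgauss m t x) (dgauss m t (x + y)) (y * dgauss m.+1 t x)) /\
  (forall t h x, s <= t -> 0 <= h ->
    jet A h (dgauss 0 t x) (dgauss 0 (t + h) x) (h * dgauss 2 t x)).
Proof.
move=> s0; have [A A1 bA] := dgauss_bound s0; exists A => //.
have A0 : 0 <= A by exact: le_trans A1.
split.
- move=> m t x y m2 st; have t0 := lt_le_trans s0 st.
  have [xy|xy] := lerP x (x + y).
    have [|||] := @jet_derive _ (dgauss m t) (dgauss m.+1 t) (dgauss m.+2 t) A
      x (x + y) A0 xy.
    + by move=> z _; apply: is_derive_dgauss => //; exact: leq_ltn_trans m2 _.
    + by move=> z _; apply: is_derive_dgauss => //; exact: leq_ltn_trans m2 _.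
    + by move=> z _; split; exact: bA.
    + by rewrite (addrC x y) addrK.
  have [|||] := @jet_derive _ (dgauss m t) (dgauss m.+1 t) (dgauss m.+2 t) A
    (x + y) x A0 (ltW xy).
  + by move=> z _; apply: is_derive_dgauss => //; exact: leq_ltn_trans m2 _.
  + by move=> z _; apply: is_derive_dgauss => //; exact: leq_ltn_trans m2 _.
  + by move=> z _; split; exact: bA.
  + by rewrite (addrC x y) addrK.
- move=> t h x st h0; have t0 := lt_le_trans s0 st.
  have th : t <= t + h by rewrite lerDl.
  have [|||] := @jet_derive _ (fun t => dgauss 0 t x) (fun t => dgauss 2 t x)
    (fun t => dgauss 4 t x) A t (t + h) A0 th.
  + move=> z /andP[tz _]; have z0 := lt_le_trans t0 tz.
    rewrite (_ : (fun t => _) = gauss^~ x); first exact: is_derive_gausst.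
    by apply/funext => r; rewrite /dgauss/= mul1r.
  + by move=> z /andP[tz _]; apply: is_derive_dgausst; exact: lt_le_trans t0 tz.
  + by move=> z /andP[tz _]; have sz := le_trans st tz; split; exact: bA.
  + by rewrite (addrC t h) addrK ger0_norm.
Qed.

End gauss.

Section kernel.
Context {R : realType} {d : nat}.
Implicit Types (x y : 'rV[R]_d) (A t h : R) (m : 'I_d -> nat).

Lemma coord_norm_le x i : `|x 0 i| <= `|x|.
Proof.
rewrite [leRHS]/Num.norm/= mx_normrE.
by apply: le_trans (le_bigmax _ _ (0, i)).
Qed.

Lemma jet_ler A r r' a a' alpha : 0 <= r -> r <= r' ->
  jet A r a a' alpha -> jet A r' a a' alpha.
Proof.
move=> r0 rr' [h1 h2 h3 h4 h5].
have A0 : 0 <= A := le_trans (normr_ge0 _) h1.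
have r'0 := le_trans r0 rr'.
split => //.
- by apply: le_trans h3 _; exact: ler_wpM2l.
- by apply: le_trans h4 _; exact: ler_wpM2l.
- by apply: le_trans h5 _; rewrite ler_wpM2l// ler_pXn2r.
Qed.

(* The space derivative of multi-index [m] of the heat kernel at time [t]. *)
Definition kap m t x : R := \prod_i dgauss (m i) t (x 0 i).

Definition addm m i : 'I_d -> nat := fun j => (m j + (j == i))%N.

Local Notation m0 := (fun=> 0%N).

Lemma kapE t x : kap m0 t x = \prod_i gauss t (x 0 i).
Proof. by apply: eq_bigr => i _; rewrite /dgauss/= mul1r. Qed.

Lemma kap_ge0 t x : 0 <= kap m0 t x.
Proof. by rewrite kapE; apply: prodr_ge0 => i _; exact/ltW/gauss_gt0. Qed.

(** [jet_prod] gives as differential the sum over i of the products with the i-th factor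
    differentiated: once for a displacement in space, twice for a time step, where the sum becomes
    the Laplacian. *)
Lemma jet_kap s : 0 < s -> exists2 A, 1 <= A &
  (forall m t x y, (forall i, m i <= 2)%N -> s <= t ->
    jet A `|y| (kap m t x) (kap m t (x + y))
      (\sum_i y 0 i * kap (addm m i) t x)) /\
  (forall t h x, s <= t -> 0 <= h ->
    jet A h (kap m0 t x) (kap m0 (t + h) x)
      (h * \sum_i kap (addm (addm m0 i) i) t x)).
Proof.
move=> s0; have [A A1 [hx ht]] := jet_dgauss s0.
exists ((3 * A) ^+ d).
  by rewrite exprn_ege1//; lra.
split.
- move=> m t x y m2 st.
  have /(jet_prod (normr_ge0 y) A1) := fun i => jet_ler (normr_ge0 _)
    (coord_norm_le y i) (hx (m i) t (x 0 i) (y 0 i) (m2 i) st).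
  congr jet.
    by apply: eq_bigr => i _; rewrite mxE.
  apply: eq_bigr => i _.
  rewrite /kap (bigD1 i)//= eqxx [in RHS](bigD1 i)//= /addm eqxx addn1 -mulrA.
  congr (_ * (_ * _)); apply: eq_bigr => j /negPf ->.
  by rewrite addn0.
- move=> t h x st h0.
  have /(jet_prod h0 A1) := fun i => ht t h (x 0 i) st h0.
  congr jet.
  rewrite mulr_sumr; apply: eq_bigr => i _;
  rewrite /kap (bigD1 i)//= eqxx [in RHS](bigD1 i)//= /addm eqxx -mulrA.
  congr (_ * (_ * _)); apply: eq_bigr => j /negPf ->.
  by [].
Qed.

End kernel.

(** * Averages of translates *)

Section measurable_rV.
Context {R : realType} {d : nat}.
Implicit Types (x y : 'rV[R]_d) (u : 'rV[R]_d -> R).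

Lemma ball_rVP x e y : 0 < e -> ball x e y <-> forall i, `|x 0 i - y 0 i| < e.
Proof.
move=> e0; rewrite -ball_normE /ball_/= /Num.norm/= mx_normrE; split.
  move=> + i; apply: le_lt_trans.
  by apply: le_trans (le_bigmax _ _ (0, i)); rewrite !mxE.
move=> h; apply/bigmax_ltP; split => // -[a i] _ /=.
by rewrite !mxE (ord1 a); exact: h.
Qed.

Lemma measurable_ball_rV x e : measurable (ball x e : set 'rV[R]_d).
Proof.
have [e0|e0] := ltP 0 e; last first.
  rewrite (_ : ball _ _ = set0)//; apply/seteqP; split=> // y.
  by rewrite -ball_normE/= => /(le_lt_trans (normr_ge0 _)); rewrite ltNge e0.
rewrite (_ : ball _ _ =
    \bigcap_(i in [set: 'I_d]) ((fun y : 'rV[R]_d => y 0 i) @^-1` (ball (x 0 i) e))).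
  apply: fin_bigcap_measurable => // i _.
  rewrite -[X in measurable X]setTI; apply: measurable_coord => //.
  exact: measurable_ball.
apply/seteqP; split => [y /(ball_rVP _ _ e0) h i _|y h]; first exact: h.
by apply/(ball_rVP _ _ e0) => i; exact: h.
Qed.

(** The sigma-algebra is generated by the coordinates, so an open set is written as a countable
    union of sup-norm balls, which are boxes, with rational centres and radii. *)
Lemma measurable_open_rV (U : set 'rV[R]_d) : open U -> measurable U.
Proof.
move=> oU.
pose I := ('rV[rat]_d * rat)%type.
pose B (i : I) : set 'rV[R]_d :=
  ball (map_mx (ratr : rat -> R) i.1 : 'rV[R]_d) (ratr i.2).
pose J := [set i : I | B i `<=` U].
have -> : U = \bigcup_(i in J) B i.
  apply/seteqP; split => [x Ux|x [i /= iU /iU]//].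
  have /nbhs_ballP[e /= e0 eU] := open_nbhs_nbhs (conj oU Ux).
  have e20 : 0 < e / 2 by rewrite divr_gt0.
  have [r] := rat_in_itvoo e20; rewrite in_itv/= => /andP[r0 re].
  have /(_ _)/cid q i : exists q : rat, x 0 i < ratr q < x 0 i + ratr r.
    have /rat_in_itvoo[q] : x 0 i < x 0 i + ratr r by rewrite ltrDl.
    by rewrite in_itv/= => qx; exists q.
  have xq i : `|ratr (projT1 (q i)) - x 0 i| < ratr r.
    case: (q i) => /= s /andP[xs sx].
    by rewrite gtr0_norm ?subr_gt0// ltrBlDl.
  exists (\row_i projT1 (q i), r); last first.
    by apply/(ball_rVP _ _ r0) => i; rewrite !mxE.
  move=> y /(ball_rVP _ _ r0)/= yq; apply: eU.
  apply/(ball_rVP _ _ e0) => i.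
  have := yq i; have := xq i; rewrite !mxE => h1 h2.
  have -> : x 0 i - y 0 i = (ratr (projT1 (q i)) - y 0 i) -
    (ratr (projT1 (q i)) - x 0 i) by ring.
  by rewrite (le_lt_trans (ler_normB _ _))//; lra.
rewrite bigcup_mkcond; apply: countable_bigcupT_measurable => [|i].
  exact: countableP.
by case: ifP => _; [exact: measurable_ball_rV|exact: measurable0].
Qed.

Lemma measurable_continuous_rV u : continuous u -> measurable_fun [set: 'rV[R]_d] u.
Proof.
move=> cu.
apply: (measurability _ (RGenOInfty.measurableE R)) => _ [_ [a ->] <-].
rewrite setTI; apply: measurable_open_rV.
by apply: open_comp => // x _; exact: cu.
Qed.

End measurable_rV.

Section averaging.
Context {R : realType} {d : nat}.
Local Notation V := 'rV[R]_d.
Implicit Types (x y z : V) (u v : V -> R) (A B a b c : R) (M : (V -> R) -> V -> R).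

(** One constant bounds both the function and its Lipschitz quotient. The class is measurable and
    stable under translations, linear combinations and averages, so it serves as the domain of the
    averaging operators. *)
Definition blip A u := (forall x, `|u x| <= A) /\
  (forall x y, `|u (x + y) - u x| <= A * `|y|).

Definition bl u := exists A, blip A u.

Lemma blip_ge0 A u : blip A u -> 0 <= A.
Proof. by move=> [/(_ 0) + _]; exact: le_trans. Qed.

Lemma blip_lin A B a b u v : blip A u -> blip B v ->
  blip (`|a| * A + `|b| * B) (fun z => a * u z + b * v z).
Proof.
move=> [u1 u2] [v1 v2]; split => [x|x y].
  rewrite (le_trans (ler_normD _ _))// !normrM lerD//; exact: ler_wpM2l.
rewrite (_ : _ - _ = a * (u (x + y) - u x) + b * (v (x + y) - v x)); last by ring.
rewrite (le_trans (ler_normD _ _))// !normrM mulrDl -!mulrA.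
by rewrite lerD//; exact: ler_wpM2l.
Qed.

Lemma bl_lin a b u v : bl u -> bl v -> bl (fun z => a * u z + b * v z).
Proof. by move=> [A uA] [B vB]; eexists; exact: blip_lin uA vB. Qed.

Lemma blip_cst a : blip `|a| (fun=> a).
Proof. by split => // x y; rewrite subrr normr0 mulr_ge0. Qed.

Lemma bl_cst a : bl (fun=> a).
Proof. by eexists; exact: blip_cst. Qed.

Lemma blip_shift A u y : blip A u -> blip A (fun z => u (z + y)).
Proof. by move=> [u1 u2]; split => // x z; rewrite addrAC. Qed.

Lemma bl_shift u y : bl u -> bl (fun z => u (z + y)).
Proof. by move=> [A uA]; exists A; exact: blip_shift. Qed.

Lemma bl_sum n (a : 'I_n -> R) (u : 'I_n -> V -> R) : (forall i, bl (u i)) ->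
  bl (fun z => \sum_i a i * u i z).
Proof.
elim: n a u => [|n IH] a u h.
  under eq_fun do rewrite big_ord0; exact: bl_cst.
under eq_fun do rewrite big_ord_recl.
have := bl_lin (a ord0) 1 (h ord0)
  (IH (fun i => a (lift ord0 i)) _ (fun i => h (lift ord0 i))).
by under eq_fun do rewrite mul1r.
Qed.

Lemma bl_sub u v : bl u -> bl v -> bl (fun z => u z - v z).
Proof.
move=> hu hv; have := bl_lin 1 (-1) hu hv.
by under eq_fun do rewrite mul1r mulN1r.
Qed.

Lemma bl_continuous u : bl u -> continuous u.
Proof.
move=> [A uA] x; have A0 := blip_ge0 uA.
apply/(@cvgrPdist_le _ _ _ (nbhs x)) => /= e e0.
have e1 : 0 < (A + 1)^-1 * e by rewrite mulr_gt0// invr_gt0 ltr_wpDl.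
apply: filterS (nbhsx_ballx x _ e1) => y; rewrite -ball_normE/= distrC => /ltW xy.
have -> : y = x + (y - x) by rewrite addrC subrK.
rewrite distrC; apply: le_trans (uA.2 _ _) _.
apply: (@le_trans _ _ ((A + 1) * `|y - x|)).
  by rewrite ler_wpM2r// lerDl.
by rewrite -ler_pdivlMl ?ltr_wpDl.
Qed.

Lemma bl_measurable u : bl u -> measurable_fun [set: V] u.
Proof. by move=> /bl_continuous; exact: measurable_continuous_rV. Qed.

(** Abstracts convolution with a finite nonnegative measure of mass [c]. It covers the long jumps,
    the Euler step with its iterates, and the heat potentials. Linearity and positivity are asked on
    [bl] only, where the integrals converge. *)
Record avg_op c M : Prop := AvgOp {
  avg_lin : forall u v a b, bl u -> bl v -> forall x,
    M (fun z => a * u z + b * v z) x = a * M u x + b * M v x;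
  avg_ge0 : forall u, bl u -> (forall x, 0 <= u x) -> forall x, 0 <= M u x;
  avg_one : forall x, M (fun=> 1) x = c;
  avg_shift : forall u y x, M (fun z => u (z + y)) x = M u (x + y) }.

Section theory.
Variables (c : R) (M : (V -> R) -> V -> R).
Hypothesis HM : avg_op c M.

Lemma avg_sub u v x : bl u -> bl v -> M (fun z => u z - v z) x = M u x - M v x.
Proof.
move=> hu hv; rewrite -[M u x]mul1r -mulN1r -(avg_lin HM)//.
by congr (M _ x); apply/funext => z; rewrite mul1r mulN1r.
Qed.

Lemma avg_cst a x : M (fun=> a) x = a * c.
Proof.
rewrite (_ : (fun=> a) = (fun z : V => a * 1 + 0 * 1)); last first.
  by apply/funext => z; rewrite mulr1 mul0r addr0.
by rewrite (avg_lin HM _ _ (bl_cst 1) (bl_cst 1)) (avg_one HM) mul0r addr0.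
Qed.

Lemma avg_sum n (a : 'I_n -> R) (u : 'I_n -> V -> R) x : (forall i, bl (u i)) ->
  M (fun z => \sum_i a i * u i z) x = \sum_i a i * M (u i) x.
Proof.
elim: n a u => [|n IH] a u h.
  under eq_fun do rewrite big_ord0.
  by rewrite big_ord0 avg_cst mul0r.
under eq_fun do rewrite big_ord_recl.
rewrite big_ord_recl -IH// -[X in _ + X]mul1r -(avg_lin HM)//; last exact: bl_sum.
by under eq_fun do rewrite -[X in _ + X]mul1r.
Qed.

Lemma avg_le u v x : bl u -> bl v -> (forall x, u x <= v x) -> M u x <= M v x.
Proof.
move=> hu hv uv; rewrite -subr_ge0 -avg_sub//.
by apply: (avg_ge0 HM) => [|z]; [exact: bl_sub|rewrite subr_ge0].
Qed.

Lemma avg_norm u B x : bl u -> (forall x, `|u x| <= B) -> `|M u x| <= c * B.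
Proof.
move=> hu uB; rewrite ler_norml mulrC -mulNr -!(avg_cst _ x); apply/andP; split.
  by apply: avg_le => [||z]//; [exact: bl_cst|have := uB z; rewrite ler_norml => /andP[]].
by apply: avg_le => [||z]//; [exact: bl_cst|have := uB z; rewrite ler_norml => /andP[]].
Qed.

Lemma avg_diff u x y : bl u -> M u (x + y) - M u x = M (fun z => u (z + y) - u z) x.
Proof. by move=> hu; rewrite avg_sub ?(avg_shift HM)//; exact: bl_shift. Qed.

Lemma avg_blip A u : blip A u -> blip (c * A) (M u).
Proof.
move=> uA; have hu : bl u by exists A.
split => [x|x y]; first by apply: avg_norm => // z; exact: uA.1.
rewrite avg_diff// -mulrA; apply: avg_norm => [|z]; last exact: uA.2.
by apply: bl_sub => //; exact: bl_shift.
Qed.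

Lemma avg_bl u : bl u -> bl (M u).
Proof. by move=> [A uA]; exists (c * A); exact: avg_blip. Qed.

(** A jet consists of five uniform bounds on linear expressions in u, u' and al, and [M] is linear
    and multiplies uniform bounds by at most c. *)
Lemma avg_jet A r (u u' al : V -> R) : bl u -> bl u' -> bl al ->
  (forall x, jet A r (u x) (u' x) (al x)) ->
  forall x, jet (c * A) r (M u x) (M u' x) (M al x).
Proof.
move=> hu hu' hal h x; rewrite /jet -!(avg_sub _)//; last exact: bl_sub.
have b1 : bl (fun z => u' z - u z) by exact: bl_sub.
have b2 : bl (fun z => u' z - u z - al z) by exact: bl_sub.
by rewrite -!mulrA; split; apply: avg_norm => // z; have [] := h z.
Qed.

End theory.

Lemma avg_comp c c' M M' : avg_op c M -> avg_op c' M' ->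
  avg_op (c * c') (fun u => M (M' u)).
Proof.
move=> HM HM'; split.
- move=> u v a b hu hv x.
  rewrite (_ : M' _ = fun z => a * M' u z + b * M' v z).
    by rewrite (avg_lin HM)//; exact: (avg_bl HM').
  by apply/funext => z; exact: (avg_lin HM').
- move=> u hu u0 x; apply: (avg_ge0 HM); first exact: (avg_bl HM').
  exact: (avg_ge0 HM').
- move=> x; rewrite (_ : M' _ = fun=> c'); last by apply/funext => z; exact: avg_one.
  by rewrite (avg_cst HM) mulrC.
- move=> u y x; rewrite -(avg_shift HM); congr (M _ x).
  by apply/funext => z; exact: (avg_shift HM').
Qed.

Lemma avg_iter M n : avg_op 1 M -> avg_op 1 (iter n M).
Proof.
move=> HM; elim: n => [|n IH]; last first.
  by have := avg_comp HM IH; rewrite mul1r.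
by split.
Qed.

(* [u1] is the gradient of [u] and [u2] its Hessian. Unlike differentiability, the
   inequalities pass to averages of translates without differentiating under the
   integral sign. *)
Definition C2jet A u (u1 : 'I_d -> V -> R) (u2 : 'I_d -> 'I_d -> V -> R) :=
  [/\ forall x y, jet A `|y| (u x) (u (x + y)) (\sum_i y 0 i * u1 i x),
      forall k x y, jet A `|y| (u1 k x) (u1 k (x + y)) (\sum_i y 0 i * u2 k i x)
    & forall k i, blip A (u2 k i)].

Lemma C2jet_blip A u (u1 : 'I_d -> V -> R) (u2 : 'I_d -> 'I_d -> V -> R) :
  C2jet A u u1 u2 ->
  blip A u /\ forall k, blip A (u1 k).
Proof.
move=> [h1 h2 _]; split => [|k]; split => [x|x y].
- by have [] := h1 x 0.
- by have [] := h1 x y.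
- by have [] := h2 k x 0.
- by have [] := h2 k x y.
Qed.

Lemma avg_C2jet c M A u (u1 : 'I_d -> V -> R) (u2 : 'I_d -> 'I_d -> V -> R) :
  avg_op c M -> C2jet A u u1 u2 ->
  C2jet (c * A) (M u) (fun i => M (u1 i)) (fun i k => M (u2 i k)).
Proof.
move=> HM h; have [hu hu1] := C2jet_blip h; have [h1 h2 h3] := h.
have hu' : bl u by exists A.
have hu1' k : bl (u1 k) by exists A.
have hu2' k i : bl (u2 k i) by exists A.
split.
- move=> x y; rewrite -(avg_shift HM) -(avg_sum HM)//.
  by apply: (avg_jet HM) => //; [exact: bl_shift|exact: bl_sum].
- move=> k x y; rewrite -(avg_shift HM) -(avg_sum HM)//.
  by apply: (avg_jet HM) => //; [exact: bl_shift|exact: bl_sum].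
- by move=> k i; exact: (avg_blip HM).
Qed.

Lemma jet_sum A r n (a a' alpha : 'I_n -> R) : 0 <= r ->
  (forall i, jet A r (a i) (a' i) (alpha i)) ->
  jet (n%:R * A) r (\sum_i a i) (\sum_i a' i) (\sum_i alpha i).
Proof.
move=> r0 h.
have s (f : 'I_n -> R) B : (forall i, `|f i| <= B) -> `|\sum_i f i| <= n%:R * B.
  move=> fB; apply: le_trans (ler_norm_sum _ _ _) _.
  apply: le_trans (ler_sum _ (fun i _ => fB i)) _.
  by rewrite sumr_const card_ord mulr_natl.
rewrite /jet -!sumrB -!mulrA.
by split; apply: s => i; have [] := h i.
Qed.

Lemma jetZ A r c a a' alpha : 0 <= c -> jet A r a a' alpha ->
  jet (c * A) r (c * a) (c * a') (c * alpha).
Proof.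
move=> c0 [h1 h2 h3 h4 h5]; rewrite /jet -!mulrBr !normrM (ger0_norm c0) -!mulrA.
by split; exact: ler_wpM2l.
Qed.

(** For n steps of length c = T/n the constant is T A, whatever n. The accuracy of the approximation
    of the jumps can thus be fixed before n. *)
Lemma C2jet_sum c A n (u : 'I_n -> V -> R)
    (u1 : 'I_n -> 'I_d -> V -> R) (u2 : 'I_n -> 'I_d -> 'I_d -> V -> R) : 0 <= c ->
  (forall m, C2jet A (u m) (u1 m) (u2 m)) ->
  C2jet (c * (n%:R * A)) (fun x => c * \sum_m u m x)
    (fun i x => c * \sum_m u1 m i x) (fun i k x => c * \sum_m u2 m i k x).
Proof.
move=> c0 h; split.
- move=> x y.
  have hj m : jet A `|y| (u m x) (u m (x + y)) (\sum_i y 0 i * u1 m i x).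
    by have [] := h m.
  have := jetZ c0 (jet_sum (normr_ge0 y) hj).
  congr jet; rewrite exchange_big mulr_sumr; apply: eq_bigr => i _.
  by rewrite [RHS]mulrCA; congr (_ * _); rewrite mulr_sumr.
- move=> k x y.
  have hj m : jet A `|y| (u1 m k x) (u1 m k (x + y)) (\sum_i y 0 i * u2 m k i x).
    by have [] := h m.
  have := jetZ c0 (jet_sum (normr_ge0 y) hj).
  congr jet; rewrite exchange_big mulr_sumr; apply: eq_bigr => i _.
  by rewrite [RHS]mulrCA; congr (_ * _); rewrite mulr_sumr.
- move=> k i.
  have s (f : 'I_n -> R) B : (forall i, `|f i| <= B) -> `|\sum_i f i| <= n%:R * B.
    move=> fB; apply: le_trans (ler_norm_sum _ _ _) _.
    apply: le_trans (ler_sum _ (fun i _ => fB i)) _.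
    by rewrite sumr_const card_ord mulr_natl.
  split => [x|x y].
    by rewrite normrM (ger0_norm c0) ler_wpM2l// s// => m; have [_ _ /(_ k i)[]] := h m.
  rewrite -mulrBr -sumrB normrM (ger0_norm c0) -!mulrA ler_wpM2l// s// => m.
  by have [_ _ /(_ k i)[]] := h m.
Qed.

End averaging.

Section integral_averaging.
Context {R : realType} {d : nat}.
Local Notation V := 'rV[R]_d.
Local Notation mu := (@lebesgue_rV R d).
Implicit Types (x y z : V) (u v : V -> R).

Lemma measurable_rV_add x (rho : V -> V) :
  measurable_fun [set: V] rho -> measurable_fun [set: V] (fun y => x + rho y).
Proof.
move=> mrho; apply: measurable_fun_rVP => i.
under eq_fun do rewrite mxE.
apply: measurable_funD => //.
exact: measurableT_comp (measurable_coord i) mrho.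
Qed.

Lemma measurable_rV_opp : measurable_fun [set: V] (fun y : V => - y).
Proof.
apply: measurable_fun_rVP => i.
under eq_fun do rewrite mxE.
by apply: measurableT_comp => //; exact: measurable_coord.
Qed.

Lemma integrable_bounded_mul (D : set V) (F m : V -> R) C : measurable D ->
  measurable_fun D F -> (forall y, D y -> `|F y| <= C) ->
  mu.-integrable D (EFin \o m) ->
  mu.-integrable D (EFin \o (fun y => F y * m y)).
Proof.
move=> mD mF FC im.
have mm : measurable_fun D m by apply/measurable_EFinP; exact: measurable_int im.
apply: (@le_integrable _ _ _ mu D mD _ (fun y => (C * m y)%:E)) => //.
- by apply/measurable_EFinP; exact: measurable_funM.
- move=> y Dy /=; rewrite lee_fin !normrM ler_wpM2r//.
  by apply: le_trans (FC _ Dy) _; exact: ler_norm.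
- exact: (integrableZl mD C im).
Qed.

Variables (D : set V) (rho : V -> V) (m : V -> R).
Hypotheses (mD : measurable D) (mrho : measurable_fun [set: V] rho)
  (im : mu.-integrable D (EFin \o m)) (m0 : forall y, D y -> 0 <= m y).

Lemma integrable_bl u x : bl u ->
  mu.-integrable D (EFin \o (fun y => u (x + rho y) * m y)).
Proof.
move=> hu; have [A [uA _]] := hu.
apply: (integrable_bounded_mul (C := A)) => //.
apply: (@measurable_funS _ _ _ _ setT) => //.
exact: measurableT_comp (bl_measurable hu) (measurable_rV_add _ mrho).
Qed.

(** Used with [rho] the identity and m = j for the long jumps, and with [rho] the opposite and m = g
    for convolution with the heat kernel. *)
Lemma avg_integral :
  avg_op (\int[mu]_(y in D) m y) (fun u x => \int[mu]_(y in D) (u (x + rho y) * m y)).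
Proof.
split.
- move=> u v a b hu hv x.
  rewrite -RintegralZl ?integrable_bl// -RintegralZl ?integrable_bl//.
  rewrite -RintegralD//.
  + by apply: eq_Rintegral => y _; ring.
  + exact: (integrableZl mD a (integrable_bl x hu)).
  + exact: (integrableZl mD b (integrable_bl x hv)).
- move=> u hu u0 x; apply: Rintegral_ge0 => y Dy.
  by rewrite mulr_ge0// m0.
- by move=> x; apply: eq_Rintegral => y _; rewrite mul1r.
- by move=> u y x; apply: eq_Rintegral => z _; rewrite addrAC.
Qed.

End integral_averaging.

Section C2.
Context {R : realType} {d : nat}.
Local Notation V := 'rV[R]_d.
Implicit Types (x y z : V) (u v : V -> R).

Lemma jet_is_derive A u (u1 : 'I_d -> V -> R) i x :
  (forall y, jet A `|y| (u x) (u (x + y)) (\sum_k y 0 k * u1 k x)) ->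
  is_derive x (delta_mx 0 i : V) u (u1 i x).
Proof.
move=> h; set e : V := delta_mx 0 i.
suff : h^-1 *: (u (h *: e + x) - u x) @[h --> 0^'] --> u1 i x.
  by move=> H; split; [apply/cvg_ex; exists (u1 i x)|exact/cvg_lim].
have A0 : 0 <= A by have [h0 _ _ _ _] := h 0; exact: le_trans h0.
apply/cvgrPdist_le => /= eps eps0.
set K := A * `|e| ^+ 2 + 1.
have K0 : 0 < K by rewrite ltr_wpDl// mulr_ge0// exprn_ge0.
have near0 : \forall r \near (0 : R)^', r != 0 /\ `|r| <= eps / K.
  near=> r; split; first by near: r; exact: nbhs_dnbhs_neq.
  near: r; apply: dnbhs0_le; exact: divr_gt0.
apply: filterS near0 => r [r0 rK].
have [_ _ _ _] := h (r *: e).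
rewrite (bigD1 i)//= big1 ?addr0; last first.
  by move=> k ki; rewrite !mxE eqxx (negPf ki) mulr0 mul0r.
rewrite !mxE !eqxx mulr1 normrZ exprMn => H.
have -> : u1 i x - r^-1 *: (u (r *: e + x) - u x) =
  - (r^-1 * (u (x + r *: e) - u x - r * u1 i x)).
  rewrite (addrC x) /GRing.scale/= [in RHS]mulrBr mulKf//; ring.
rewrite normrN normrM normfV ler_pdivrMl ?normr_gt0//.
apply: le_trans H _.
have -> : A * (`|r| ^+ 2 * `|e| ^+ 2) = `|r| * (`|r| * (A * `|e| ^+ 2)) by ring.
rewrite ler_wpM2l//.
apply: (@le_trans _ _ (`|r| * K)); first by rewrite ler_wpM2l// lerDl.
by rewrite -ler_pdivlMr.
Unshelve. all: by end_near. Qed.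

Section facts.
Variables (A : R) (u : V -> R) (u1 : 'I_d -> V -> R) (u2 : 'I_d -> 'I_d -> V -> R).
Hypothesis hu : C2jet A u u1 u2.

Lemma C2jet_is_derive i x : is_derive x (delta_mx 0 i : V) u (u1 i x).
Proof. by have [h _ _] := hu; apply: jet_is_derive => y; exact: h. Qed.

Lemma C2jet_is_derive1 i k x :
  is_derive x (delta_mx 0 k : V) (u1 i) (u2 i k x).
Proof. by have [_ h _] := hu; apply: jet_is_derive => y; exact: h. Qed.

Lemma C2jet_partial i : partial i u = u1 i.
Proof. by apply/funext => x; have [_ h] := C2jet_is_derive i x. Qed.

Lemma C2jet_partial2 i k : partial k (partial i u) = u2 i k.
Proof.
rewrite C2jet_partial; apply/funext => x.
by have [_ h] := C2jet_is_derive1 i k x.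
Qed.

Lemma C2jet_closure G : C2_closure G u.
Proof.
have [bu bu1] := C2jet_blip hu; have [_ _ bu2] := hu.
have cont v B : blip B v -> {within closure G, continuous v}.
  by move=> bv; apply: continuous_subspaceT; apply: bl_continuous; exists B.
split; first exact: cont bu.
- move=> i; split; first by move=> x _; have [] := C2jet_is_derive i x.
  by exists (u1 i); [exact: cont (bu1 i)|move=> x _; rewrite C2jet_partial].
- move=> i k; split.
    by move=> x _; rewrite C2jet_partial; have [] := C2jet_is_derive1 i k x.
  exists (u2 i k); [exact: cont (bu2 i k)|move=> x _].
  by rewrite C2jet_partial2.
Qed.

Lemma C2jet_patch_partial v G i x : open G -> G x ->
  partial i (patch v G u) x = u1 i x.
Proof.
move=> oG Gx; rewrite -C2jet_partial; apply: near_eq_derive.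
have /open_nbhs_nbhs := conj oG Gx : open_nbhs x G.
by apply: filterS => y Gy; rewrite patchT// inE.
Qed.

Lemma C2jet_patch_partial2 v G i k x : open G -> G x ->
  partial k (partial i (patch v G u)) x = u2 i k x.
Proof.
move=> oG Gx; rewrite -C2jet_partial2; apply: near_eq_derive.
have /open_nbhs_nbhs := conj oG Gx : open_nbhs x G.
by apply: filterS => y Gy; rewrite C2jet_partial C2jet_patch_partial.
Qed.

End facts.

End C2.

(** * The jump operator *)

Section jump.
Context {R : realType} {d : nat}.
Local Notation V := 'rV[R]_d.
Local Notation mu := (@lebesgue_rV R d).
Implicit Types (x y z : V) (u v : V -> R).

Lemma enorm_ge0 y : 0 <= enorm y.
Proof. exact: sqrtr_ge0. Qed.

Lemma coord_le_enorm y i : `|y 0 i| <= enorm y.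
Proof.
rewrite -sqrtr_sqr ler_wsqrtr// /dot (bigD1 i)//= -expr2 lerDl.
by apply: sumr_ge0 => k _; rewrite -expr2 sqr_ge0.
Qed.

Lemma norm_le_enorm y : `|y| <= enorm y.
Proof.
rewrite [leLHS]/Num.norm/= mx_normrE; apply/bigmax_leP; split; first exact: enorm_ge0.
by move=> [a i] _ /=; rewrite (ord1 a) coord_le_enorm.
Qed.

Lemma measurable_enorm : measurable_fun [set: V] (@enorm R d).
Proof.
rewrite /enorm; apply: measurableT_comp.
  by apply: continuous_measurable_fun; exact: sqrt_continuous.
rewrite /dot; apply: measurable_sum => i; apply: measurable_funM; exact: measurable_coord.
Qed.

Lemma measurable_punctured : measurable (@punctured R d).
Proof.
rewrite (_ : punctured = ~` [set y : V | enorm y <= 0]).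
  apply: measurableC.
  have := measurable_enorm measurableT (measurable_itv `]-oo, (0:R)]).
  rewrite setTI; congr measurable; apply/seteqP; split => y /=; by rewrite in_itv.
apply/seteqP; split => y /=; rewrite /punctured/=.
  move=> y0 /(le_trans (norm_le_enorm y)); rewrite normr_le0.
  exact/negP.
move=> h; apply/negP => /eqP y0; apply: h; rewrite y0.
by rewrite /enorm /dot big1 ?sqrtr0// => i _; rewrite mxE mul0r.
Qed.

Lemma measurable_enorm_le e : measurable [set y : V | enorm y <= e].
Proof.
have := measurable_enorm measurableT (measurable_itv `]-oo, e]).
by rewrite setTI; congr measurable; apply/seteqP; split => y /=; rewrite in_itv.
Qed.

Lemma measurable_small_dot (g : 'I_d -> R) :
  measurable_fun [set: V] (fun y => if enorm y <= 1 then \sum_i y 0 i * g i else 0).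
Proof.
apply: measurable_fun_ifT => //.
  apply: (measurable_fun_bool true).
  rewrite setTI; exact: (measurable_enorm_le 1).
apply: measurable_sum => i; apply: measurable_funM => //; exact: measurable_coord.
Qed.

Variable j : V -> R.
Hypothesis hj : jump_kernel j.

Let m y := Num.min 1 (enorm y ^+ 2) * j y.

Let m_ge0 y : punctured y -> 0 <= m y.
Proof.
move=> y0; have [_ j0 _] := hj; rewrite mulr_ge0 ?j0//.
by rewrite le_min ler01 sqr_ge0.
Qed.

Let min_ge0 y : 0 <= Num.min 1 (enorm y ^+ 2).
Proof. by rewrite le_min ler01 sqr_ge0. Qed.

Lemma measurable_min_enorm :
  measurable_fun [set: V] (fun y : V => Num.min 1 (enorm y ^+ 2)).
Proof.
apply: measurable_minr => //.
apply: measurable_funX; exact: measurable_enorm.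
Qed.

Let mm : measurable_fun punctured m.
Proof.
have [mj _ _] := hj; apply: measurable_funM => //.
apply: (@measurable_funS _ _ _ _ setT) => //.
exact: measurable_min_enorm.
Qed.

Lemma integrable_min_jump : mu.-integrable punctured (EFin \o m).
Proof.
apply/integrableP; split; first exact/measurable_EFinP.
have [_ _] := hj; congr (_ < _)%E; apply: eq_integral => y.
by rewrite inE => y0 /=; rewrite ger0_norm ?m_ge0.
Qed.

Lemma integrable_jump (D : set V) (F : V -> R) C : measurable D -> D `<=` punctured ->
  measurable_fun D F ->
  (forall y, D y -> `|F y| <= C * Num.min 1 (enorm y ^+ 2)) ->
  mu.-integrable D (EFin \o (fun y => F y * j y)).
Proof.
move=> mD Dp mF FC; have [mj j0 _] := hj.
have imD := integrableS measurable_punctured mD Dp integrable_min_jump.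
apply: (@le_integrable _ _ _ mu D mD _ (fun y => (C * m y)%:E)) => //.
- apply/measurable_EFinP; apply: measurable_funM => //.
  by apply: (@measurable_funS _ _ _ _ punctured) => //; exact: measurable_punctured.
- move=> y Dy /=; rewrite lee_fin normrM.
  have jy := j0 _ (Dp _ Dy); rewrite (ger0_norm jy).
  apply: (@le_trans _ _ (C * m y)); last exact: ler_norm.
  by rewrite /m mulrA ler_wpM2r// FC.
- exact: (integrableZl mD C imD).
Qed.

(** The gradient is a separate argument, so that a function and its patched version, which have the
    same gradient at x, are compared with literally the same compensator. *)
Definition jump_part u (g : 'I_d -> R) x :=
  \int[mu]_(y in punctured)
    ((u (x + y) - u x - (if enorm y <= 1 then \sum_i y 0 i * g i else 0)) * j y).

Lemma dot_grad y u x : dot y (grad u x) = \sum_i y 0 i * partial i u x.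
Proof. by apply: eq_bigr => i _; rewrite mxE. Qed.

Lemma jump_opE u x : jump_op j u x =
  \sum_i partial i (partial i u) x + jump_part u (fun i => partial i u x) x.
Proof.
rewrite /jump_op /jump_part; congr (_ + _); apply: eq_Rintegral => y _.
by rewrite dot_grad.
Qed.

Lemma dot_bound A (g : 'I_d -> R) y : 0 <= A -> (forall i, `|g i| <= A) ->
  `|\sum_i y 0 i * g i| <= d%:R * A * enorm y.
Proof.
move=> A0 gA; apply: le_trans (ler_norm_sum _ _ _) _.
apply: (@le_trans _ _ (\sum_(i < d) A * enorm y)).
  apply: ler_sum => i _; rewrite normrM mulrC; apply: ler_pM => //.
  exact: coord_le_enorm.
by rewrite sumr_const card_ord mulr_natl mulrnAl.
Qed.

Lemma small_dot_bound A (g : 'I_d -> R) y : 0 <= A -> (forall i, `|g i| <= A) ->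
  `|if enorm y <= 1 then \sum_i y 0 i * g i else 0| <= d%:R * A.
Proof.
move=> A0 gA; have dA : 0 <= d%:R * A by rewrite mulr_ge0.
case: ifP => [y1|]; last by rewrite normr0.
by apply: le_trans (dot_bound _ A0 gA) _; rewrite ler_piMr.
Qed.

Lemma measurable_jump_part u (g : 'I_d -> R) x : measurable_fun [set: V] u ->
  measurable_fun [set: V] (fun y => u (x + y) - u x -
    (if enorm y <= 1 then \sum_i y 0 i * g i else 0)).
Proof.
move=> mu'; apply: measurable_funB; last exact: measurable_small_dot.
apply: measurable_funB => //.
by apply: measurableT_comp mu' _; exact: measurable_rV_add.
Qed.

(* A patched function agrees with [phi] near [x], whence the quadratic bound;
   at distance at least [r] boundedness suffices as [1 <= r^-2 |y|^2] there. *)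
Lemma jump_integrable_near A B r u (g : 'I_d -> R) x : 0 <= A -> 0 < r ->
  measurable_fun [set: V] u -> (forall z, `|u z| <= B) -> (forall i, `|g i| <= A) ->
  (forall y, enorm y <= r ->
    `|u (x + y) - u x - \sum_i y 0 i * g i| <= A * enorm y ^+ 2) ->
  mu.-integrable punctured (EFin \o (fun y =>
    (u (x + y) - u x - (if enorm y <= 1 then \sum_i y 0 i * g i else 0)) * j y)).
Proof.
move=> A0 r0 mu' uB gA h.
have B0 : 0 <= B := le_trans (normr_ge0 _) (uB 0).
set s := Num.min 1 r; have s0 : 0 < s by rewrite lt_min ltr01.
set K := B + B + d%:R * A.
have K0 : 0 <= K by rewrite !addr_ge0// mulr_ge0.
have KE y : `|u (x + y) - u x - (if enorm y <= 1 then \sum_i y 0 i * g i else 0)| <= K.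
  rewrite (le_trans (ler_normB _ _))// lerD//; last exact: small_dot_bound.
  by rewrite (le_trans (ler_normB _ _))// lerD.
apply: (integrable_jump (C := A + K / s ^+ 2)) => //.
- exact: measurable_punctured.
- apply: (@measurable_funS _ _ _ _ setT) => //; exact: measurable_jump_part.
- move=> y y0.
  have [ys|ys] := leP (enorm y) s.
    have y1 : enorm y <= 1 by rewrite (le_trans ys)// ge_min lexx.
    have yr : enorm y <= r by rewrite (le_trans ys)// ge_min lexx orbT.
    rewrite y1 min_r; last by rewrite expr_le1 ?enorm_ge0.
    apply: le_trans (h _ yr) _; rewrite ler_wpM2r ?sqr_ge0// lerDl.
    by rewrite divr_ge0// sqr_ge0.
  apply: le_trans (KE y) _.
  have s1 : s <= 1 by rewrite ge_min lexx.
  have sm : s ^+ 2 <= Num.min 1 (enorm y ^+ 2).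
    rewrite le_min expr_le1 ?(ltW s0)// s1/= ler_pXn2r ?nnegrE ?(ltW s0) ?enorm_ge0//.
    exact: ltW.
  apply: (@le_trans _ _ (K / s ^+ 2 * Num.min 1 (enorm y ^+ 2))).
    by rewrite -mulrA ler_peMr// ler_pdivlMl ?exprn_gt0// mulr1.
  by rewrite ler_wpM2r// lerDr.
Qed.

Section C2.
Variables (A : R) (u : V -> R) (u1 : 'I_d -> V -> R) (u2 : 'I_d -> 'I_d -> V -> R).
Hypothesis hu : C2jet A u u1 u2.

Let A0 : 0 <= A.
Proof. by have [/blip_ge0] := C2jet_blip hu. Qed.

Lemma C2jet_taylor x y : `|u (x + y) - u x - \sum_i y 0 i * u1 i x| <= A * enorm y ^+ 2.
Proof.
have [h _ _] := hu; have [_ _ _ _ /le_trans] := h x y; apply.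
by rewrite ler_wpM2l// ler_pXn2r ?nnegrE ?enorm_ge0// norm_le_enorm.
Qed.

Lemma jump_op_C2 x : jump_op j u x = \sum_i u2 i i x + jump_part u (u1^~ x) x.
Proof.
rewrite jump_opE; congr (_ + _).
  by apply: eq_bigr => i _; rewrite (C2jet_partial2 hu).
by congr jump_part; apply/funext => i; rewrite (C2jet_partial hu).
Qed.

Lemma jump_C2_integrable x : mu.-integrable punctured (EFin \o (fun y =>
    (u (x + y) - u x - (if enorm y <= 1 then \sum_i y 0 i * u1 i x else 0)) * j y)).
Proof.
have [bu bu1] := C2jet_blip hu.
apply: (@jump_integrable_near A A 1) => //.
- by apply: bl_measurable; exists A.
- exact: bu.1.
- by move=> i; exact: (bu1 i).1.
- by move=> y _; exact: C2jet_taylor.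
Qed.

(** The maximum principle for L: patching changes nothing near x, hence neither the local part nor
    the compensator, and lowers the values elsewhere, hence the integrand. Both integrals are shown
    to converge, as a divergent one would have a default value. *)
Lemma jump_op_patch v (G : set V) x B : continuous v -> (forall z, `|v z| <= B) ->
  open G -> G x -> (forall z, v z <= u z) ->
  jump_op j (patch v G u) x <= jump_op j u x.
Proof.
move=> cv vB oG Gx vu; have [bu bu1] := C2jet_blip hu.
rewrite jump_op_C2 jump_opE.
have -> : (fun i => partial i (patch v G u) x) = u1^~ x.
  by apply/funext => i; exact: (C2jet_patch_partial hu).
have -> : \sum_i partial i (partial i (patch v G u)) x = \sum_i u2 i i x.
  by apply: eq_bigr => i _; exact: (C2jet_patch_partial2 hu).
rewrite lerD2l; set w := patch v G u.
have wx : w x = u x by rewrite /w patchT// inE.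
have wu z : w z <= u z by rewrite /w /patch; case: ifPn.
have /open_nbhs_nbhs/nbhs_ballP[r /= r0 rG] := conj oG Gx : open_nbhs x G.
have r20 : 0 < r / 2 by rewrite divr_gt0.
apply: le_Rintegral.
- exact: measurable_punctured.
- apply: (@jump_integrable_near A (A + B) (r / 2)) => //.
  + apply: measurable_fun_ifT => /=.
    * apply: (measurable_fun_bool true); rewrite setTI.
      rewrite (_ : _ @^-1` _ = G); first exact: measurable_open_rV.
      by apply/seteqP; split => z /=; [move/set_mem|move/mem_set].
    * by apply: bl_measurable; exists A.
    * exact: measurable_continuous_rV.
  + move=> z; have B0 := le_trans (normr_ge0 _) (vB z).
    rewrite /w /patch; case: ifP => _.
      by rewrite (le_trans (bu.1 z))// lerDl.
    by rewrite (le_trans (vB z))// lerDr.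
  + by move=> i; exact: (bu1 i).1.
  + move=> y yr; rewrite wx (_ : w (x + y) = u (x + y)) ?C2jet_taylor//.
    rewrite /w patchT// inE; apply: rG; rewrite -ball_normE/=.
    rewrite opprD addNKr normrN (le_lt_trans (norm_le_enorm y))// (le_lt_trans yr)//.
    by rewrite ltr_pdivrMr// ltr_pMr// ltr1n.
- exact: jump_C2_integrable.
- move=> y y0; have [_ j0 _] := hj; rewrite ler_wpM2r ?j0//.
  by rewrite lerB// wx lerB.
Qed.

End C2.
End jump.

(** * Approximation of the jump part by averages *)

Section averaging_more.
Context {R : realType} {d : nat}.
Local Notation V := 'rV[R]_d.
Implicit Types (x y z : V) (u v : V -> R).

Lemma avg_add (a b c c' : R) (M M' : (V -> R) -> V -> R) : 0 <= a -> 0 <= b ->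
  avg_op c M -> avg_op c' M' ->
  avg_op (a * c + b * c') (fun u x => a * M u x + b * M' u x).
Proof.
move=> a0 b0 HM HM'; split.
- move=> u v a' b' hu hv x; rewrite (avg_lin HM)// (avg_lin HM')//; ring.
- move=> u hu u0 x; rewrite addr_ge0// mulr_ge0//.
    exact: (avg_ge0 HM).
  exact: (avg_ge0 HM').
- by move=> x; rewrite (avg_one HM) (avg_one HM').
- by move=> u y x; rewrite (avg_shift HM) (avg_shift HM').
Qed.

Lemma avg_translate (t : V) : avg_op 1 (fun u x => u (x + t)).
Proof. by split=> // u y x; rewrite addrAC. Qed.

Lemma avg_id : avg_op 1 (fun u : V -> R => u).
Proof. by split. Qed.

End averaging_more.

Lemma Rintegral_sum d (T : measurableType d) (R : realType)
    (mu : {measure set T -> \bar R}) (D : set T) n (f : 'I_n -> T -> R) :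
  measurable D -> (forall i, mu.-integrable D (EFin \o f i)) ->
  mu.-integrable D (EFin \o (fun y => \sum_i f i y)) /\
  \int[mu]_(y in D) (\sum_i f i y) = \sum_i \int[mu]_(y in D) f i y.
Proof.
move=> mD; elim: n f => [|n IH] f fi.
  under [X in EFin \o X]eq_fun do rewrite big_ord0.
  split; first exact: integrable0.
  under eq_Rintegral do rewrite big_ord0.
  by rewrite big_ord0 Rintegral_cst// mul0r.
have [ii iE] := IH (fun i => f (lift ord0 i)) (fun i => fi (lift ord0 i)).
under [X in EFin \o X]eq_fun do rewrite big_ord_recl.
under eq_Rintegral do rewrite big_ord_recl.
split; first exact: (integrableD mD (fi ord0) ii).
by rewrite RintegralD// iE big_ord_recl.
Qed.

Section jump_approx.
Context {R : realType} {d : nat}.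
Local Notation V := 'rV[R]_d.
Local Notation mu := (@lebesgue_rV R d).
Implicit Types (x y z : V) (u v : V -> R).
Variable j : V -> R.
Hypothesis hj : jump_kernel j.

Let m y := Num.min 1 (enorm y ^+ 2) * j y.

(** Dominated convergence along the balls of radius 1/(n+1), which shrink to the excluded origin.
    With eps <= 1 all the jumps removed later are compensated ones. *)
Lemma small_jumps e : 0 < e -> exists2 eps : R, 0 < eps <= 1 &
  \int[mu]_(y in punctured `&` [set y : V | enorm y <= eps]) m y <= e.
Proof.
move=> e0; have im := integrable_min_jump hj.
pose S n := [set y : V | enorm y <= n.+1%:R^-1 :> R].
have mS n : measurable (S n) by exact: measurable_enorm_le.
have mp := @measurable_punctured R d.
have [_ j0 _] := hj.
have m0 y : punctured y -> 0 <= m y.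
  by move=> y0; rewrite mulr_ge0 ?j0// le_min ler01 sqr_ge0.
have mm : measurable_fun punctured m by apply/measurable_EFinP; exact: measurable_int im.
have [|||||_ _] := @dominated_convergence _ _ R mu punctured mp
    (fun n y => ((m \_ (S n)) y)%:E) (fun=> 0%E) (EFin \o m).
- move=> n; apply/measurable_EFinP; apply/measurable_restrict => //.
  apply: (@measurable_funS _ _ _ _ punctured) => //.
- exact: measurable_cst.
- apply: aeW => y y0; apply: cvg_near_cst.
  have ey : 0 < enorm y.
    by rewrite (lt_le_trans _ (norm_le_enorm y))// normr_gt0.
  apply: filterS (near_infty_natSinv_lt (PosNum ey)) => n /= ny.
  by rewrite patchN//; apply/negP; rewrite inE /S/= leNgt ny.
- exact: im.
- apply: aeW => y n y0; rewrite /= lee_fin /patch; case: ifP => _.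
    by rewrite ger0_norm ?m0.
  by rewrite normr0 m0.
rewrite integral0 => /fine_cvgP[_ /cvgrPdist_le/(_ _ e0)[n _ /(_ n (leqnn _))]].
rewrite /= sub0r normrN => h.
exists n.+1%:R^-1; first by rewrite invr_gt0 ltr0n/= invf_le1 ?ltr0n// ler1n.
rewrite Rintegral_mkcondr.
exact: le_trans (ler_norm _) h.
Qed.

(* Jumps shorter than [eps] cost [A] times their second moment; the compensator
   [b] of the others is replaced by jumps of [- eta b] at rate [eta^-1]. *)
Lemma jump_approx e : 0 < e -> exists2 Lam : R, 0 <= Lam & exists2 P,
  avg_op Lam P &
  forall A u (u1 : 'I_d -> V -> R) (u2 : 'I_d -> 'I_d -> V -> R),
    C2jet A u u1 u2 -> forall x,
    jump_part j u (u1^~ x) x <= P u x - Lam * u x + A * e.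
Proof.
move=> e0; have e20 : 0 < e / 2 by rewrite divr_gt0.
have [eps /andP[eps0 eps1] smallE] := small_jumps e20.
have mp := @measurable_punctured R d.
pose S := punctured `&` [set y : V | enorm y <= eps].
pose G := punctured `\` [set y : V | enorm y <= eps].
have mle := @measurable_enorm_le R d eps.
have mS : measurable S by exact: measurableI.
have mG : measurable G by exact: measurableD.
have Sp : S `<=` punctured by move=> y [].
have Gp : G `<=` punctured by move=> y [].
have [_ j0 _] := hj.
(* On G the weight min(1, |y|^2) is at least eps^2. *)
have ij : mu.-integrable G (EFin \o j).
  have : mu.-integrable G (EFin \o (fun y => 1 * j y)).
    apply: (integrable_jump hj (C := eps ^- 2)) => // y [_ /= /negP].
    rewrite -ltNge => ey; rewrite normr1 ler_pdivlMl ?exprn_gt0// mulr1.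
    rewrite le_min expr_le1 ?(ltW eps0)// eps1/=.
    by rewrite ler_pXn2r ?nnegrE ?enorm_ge0//; exact: ltW.
  by congr integrable; apply/funext => y /=; rewrite mul1r.
pose b : V := \row_i \int[mu]_(y in G) ((if enorm y <= 1 then y 0 i else 0) * j y).
(* The Taylor remainder A (eta |b|)^2 of a jump by - eta b, taken at rate 1/eta, is then at most A
   e/2. The other half of A e pays for the short jumps. *)
pose eta := e / 2 / (1 + `|b| ^+ 2).
have b0 : 0 < 1 + `|b| ^+ 2 by rewrite ltr_wpDr// sqr_ge0.
have eta0 : 0 < eta by rewrite divr_gt0.
have ieta0 : 0 <= eta^-1 by rewrite invr_ge0 ltW.
have jG0 y : G y -> 0 <= j y by move=> /Gp/j0.
have mid : measurable_fun [set: V] (@id V) by exact: measurable_id.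
have Havg := avg_add ler01 ieta0 (avg_integral mG mid ij jG0)
  (avg_translate (- (eta *: b))).
exists (1 * \int[mu]_(y in G) j y + eta^-1 * 1).
  by rewrite mul1r mulr1 addr_ge0// Rintegral_ge0.
eexists; first exact: Havg.
move=> A u u1 u2 hu x.
have [bu bu1] := C2jet_blip hu; have A0 := blip_ge0 bu.
have hbu : bl u by exists A.
have iF := jump_C2_integrable hj hu x.
pose F y := u (x + y) - u x - (if enorm y <= 1 then \sum_i y 0 i * u1 i x else 0).
have SG : S `|` G = punctured by rewrite /S /G setUIDK.
have -> : jump_part j u (u1^~ x) x =
    \int[mu]_(y in S) (F y * j y) + \int[mu]_(y in G) (F y * j y).
  rewrite /jump_part -{1}SG Rintegral_setU//; first by rewrite SG.
  by apply/disj_setPS => y [[_ /= h] [_ /=]].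
have hS : \int[mu]_(y in S) (F y * j y) <= A * (e / 2).
  apply: (@le_trans _ _ (A * \int[mu]_(y in S) m y)); last by rewrite ler_wpM2l.
  have imS : mu.-integrable S (EFin \o m).
    exact: integrableS (integrable_min_jump hj).
  rewrite -RintegralZl//; apply: le_Rintegral => //.
  - exact: integrableS iF.
  - exact: (integrableZl mS A imS).
  - move=> y [y0 /= ye]; rewrite /m mulrA ler_wpM2r ?j0//.
    have y1 : enorm y <= 1 by exact: le_trans eps1.
    rewrite min_r; last by rewrite expr_le1 ?enorm_ge0.
    by rewrite /F y1; apply: le_trans (ler_norm _) _; exact: (C2jet_taylor hu).
have i1 : mu.-integrable G (EFin \o (fun y => u (x + y) * j y)).
  exact: (@integrable_bl R d G id j mG mid ij u x hbu).
have i2 : mu.-integrable G (EFin \o (fun y => u x * j y)).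
  exact: (integrableZl mG (u x) ij).
have i3' i : mu.-integrable G
    (EFin \o (fun y => (if enorm y <= 1 then y 0 i else 0) * j y)).
  apply: (integrable_bounded_mul (C := 1)) => //.
    apply: (@measurable_funS _ _ _ _ setT) => //.
    apply: measurable_fun_ifT => //; last exact: measurable_coord.
    by apply: (measurable_fun_bool true); rewrite setTI; exact: (measurable_enorm_le 1).
  move=> y _; case: ifP => y1; last by rewrite normr0.
  exact: le_trans (coord_le_enorm _ _) y1.
have i3 i : mu.-integrable G
    (EFin \o (fun y => u1 i x * ((if enorm y <= 1 then y 0 i else 0) * j y))).
  exact: (integrableZl mG (u1 i x) (i3' i)).
have [i4 i4E] := Rintegral_sum mG i3.
have hG : \int[mu]_(y in G) (F y * j y) = \int[mu]_(y in G) (u (x + y) * j y) -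
    u x * \int[mu]_(y in G) j y - \sum_i b 0 i * u1 i x.
  rewrite -RintegralZl// -RintegralB// (_ : \sum_i _ = \sum_i
      \int[mu]_(y in G) (u1 i x * ((if enorm y <= 1 then y 0 i else 0) * j y))); last first.
    by apply: eq_bigr => i _; rewrite mxE mulrC RintegralZl//; exact: i3'.
  rewrite -i4E -RintegralB//; last exact: (integrableB mG i1 i2).
  apply: eq_Rintegral => y _; rewrite /F.
  case: ifP => y1; last first.
    by rewrite big1 ?subr0 ?mulrBl// => i _; rewrite mul0r mulr0.
  rewrite !mulrBl; congr (_ - _); rewrite mulr_suml; apply: eq_bigr => i _.
  by rewrite mulrCA mulrA.
have [h _ _] := hu; have [_ _ _ _] := h x (- (eta *: b)).
have -> : \sum_i (- (eta *: b)) 0 i * u1 i x = - (eta * \sum_i b 0 i * u1 i x).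
  rewrite mulr_sumr -sumrN; apply: eq_bigr => i _.
  by rewrite !mxE; ring.
rewrite normrN normrZ (gtr0_norm eta0) ler_norml => /andP[hb _].
set sb := \sum_i _ in hb hG.
have hsb : - sb <= eta^-1 * (u (x - eta *: b) - u x) + A * (e / 2).
  rewrite -(ler_pM2l eta0) mulrDr mulrA mulfV ?gt_eqF// mul1r.
  have : A * (eta * `|b|) ^+ 2 <= eta * (A * (e / 2)).
    rewrite exprMn [leRHS]mulrCA ler_wpM2l// expr2 -mulrA ler_pM2l//.
    apply: (@le_trans _ _ (eta * (1 + `|b| ^+ 2))).
      by rewrite ler_wpM2l ?(ltW eta0)// lerDr.
    by rewrite /eta divfK// gt_eqF.
  lra.
rewrite hG; lra.
Qed.
End jump_approx.

(** * The supersolution obtained from Euler steps *)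

Section supersolution.
Context {R : realType} {d : nat}.
Local Notation V := 'rV[R]_d.
Implicit Types (x y z : V) (u : V -> R).

(** Write v_k = v(kh) and N = 1 + h (P - Lam). Then (P - Lam) w is the sum of N^(k+1) v_k - N^k v_k,
    and the Laplacian of w is, up to A h^2 per step, the sum of N^k v_(k+1) - N^k v_k. Their sum
    differs from the telescoping N^(k+1) v_(k+1) - N^k v_k by (N^k - N^(k+1)) (v_(k+1) - v_k), again
    of order h^2. The n errors add up to a multiple of h. The parameter [n0] lets the caller demand
    a small step. *)
Lemma supersolution (j : V -> R) (v : R -> V -> R) (v1 : R -> 'I_d -> V -> R)
    (v2 : R -> 'I_d -> 'I_d -> V -> R) (A T e : R) (b : R -> R) (n0 : nat) :
  jump_kernel j -> 0 < T -> 0 < e ->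
  (forall t, 0 <= t -> C2jet A (v t) (v1 t) (v2 t)) ->
  (forall t h x, 0 <= t -> 0 <= h ->
     jet A h (v t x) (v (t + h) x) (h * \sum_i v2 t i i x)) ->
  (forall t x, 0 <= t -> 0 <= v t x <= b t) ->
  exists n, (n0 < n)%N /\ exists A' w w1 w2, [/\ C2jet A' w w1 w2,
    forall x, 0 <= w x <= T / n%:R * \sum_(k < n) b (T / n%:R * k%:R) &
    forall x, jump_op j w x <= b T - v 0 x + e].
Proof.
move=> hj T0 e0 hv ht vb.
have A0 : 0 <= A.
  by have [/(_ 0 0)[h _ _ _ _] _ _] := hv 0 (lexx _); exact: le_trans h.
have TA0 : 0 < T * A + 1 by rewrite ltr_wpDl// mulr_ge0// ltW.
pose e1 := e / 2 / (T * A + 1).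
have e10 : 0 < e1 by rewrite !divr_gt0.
have [Lam Lam0 [P HP Papprox]] := jump_approx hj e10.
(* The first summand yields h Lam <= 1, so that N is a convex combination; the second makes the
   accumulated error T A h (1 + 2 Lam) at most e/2. *)
pose K := T * Lam + T * (T * A * (1 + 2 * Lam)) / (e / 2).
have K0 : 0 <= K.
  rewrite addr_ge0 ?mulr_ge0 ?(ltW T0)// ?addr_ge0 ?mulr_ge0//.
  by rewrite invr_ge0 divr_ge0// ltW.
pose n := (n0 + (Num.truncn K).+1)%N.
have nK : K <= n%:R.
  apply: (@le_trans _ _ (Num.truncn K).+1%:R); first by rewrite ltW// truncnS_gt.
  by rewrite ler_nat leq_addl.
have n_gt0 : 0 < n%:R :> R by rewrite ltr0n /n addnS.
pose h := T / n%:R.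
have h0 : 0 < h by rewrite divr_gt0.
have hn : h * n%:R = T by rewrite divfK// gt_eqF.
have h0' := ltW h0.
have K1 : T * Lam <= K.
  by rewrite lerDl mulr_ge0 ?invr_ge0 ?mulr_ge0 ?addr_ge0 ?mulr_ge0 ?divr_ge0// ltW.
have K2 : T * (T * A * (1 + 2 * Lam)) / (e / 2) <= K by rewrite lerDr mulr_ge0// ltW.
have hLam : h * Lam <= 1.
  rewrite -(ler_pM2r n_gt0) mulrAC hn mul1r; exact: le_trans K1 nK.
have herr : T * A * h * (1 + 2 * Lam) <= e / 2.
  rewrite -(ler_pM2r n_gt0).
  have -> : T * A * h * (1 + 2 * Lam) * n%:R = T * (T * A * (1 + 2 * Lam)).
    by transitivity (T * A * (h * n%:R) * (1 + 2 * Lam)); [ring|rewrite hn]; ring.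
  by rewrite [leRHS]mulrC -ler_pdivrMr ?divr_gt0//; exact: le_trans K2 nK.
pose N u x := (1 - h * Lam) * u x + h * P u x.
have HN : avg_op 1 N.
  have := avg_add (_ : 0 <= 1 - h * Lam) h0' avg_id HP.
  rewrite mulr1 subrK; apply; by rewrite subr_ge0.
have NE u x : N u x = u x + h * (P u x - Lam * u x) by rewrite /N; ring.
pose t (k : nat) := h * k%:R.
have t0 k : 0 <= t k by rewrite mulr_ge0.
have tS k : t k.+1 = t k + h by rewrite /t mulrSr mulrDr mulr1.
have HNk k := avg_iter k HN.
pose phi k := iter k N (v (t k)).
have phiC k : C2jet A (phi k) (fun i => iter k N (v1 (t k) i))
    (fun i l => iter k N (v2 (t k) i l)).
  by have := avg_C2jet (HNk k) (hv _ (t0 k)); rewrite mul1r.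
have blv k : bl (v (t k)) by have [? _] := C2jet_blip (hv _ (t0 k)); exists A.
have blv2 k i l : bl (v2 (t k) i l) by have [_ _ h2] := hv _ (t0 k); exists A.
have blphi k : bl (phi k) by have [? _] := C2jet_blip (phiC k); exists A.
have phib k x : 0 <= phi k x <= b (t k).
  rewrite (avg_ge0 (HNk k))//=; last by move=> y; have /andP[] := vb _ y (t0 k).
  have -> : b (t k) = iter k N (fun=> b (t k)) x by rewrite (avg_cst (HNk k)) mulr1.
  apply: (avg_le (HNk k)) => //; first exact: bl_cst.
  by move=> y; have /andP[] := vb _ y (t0 k).
have wC := C2jet_sum h0' (fun k : 'I_n => phiC k).
set w := (fun x => h * \sum_(k < n) phi k x) in wC.
exists n; split; first by rewrite /n addnS ltnS leq_addr.
do 4 eexists; split; first exact: wC.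
  move=> x; rewrite /w mulr_ge0//=; last first.
    by apply: sumr_ge0 => k _; have /andP[] := phib k x.
  rewrite ler_wpM2l//; apply: ler_sum => k _.
  by have /andP[] := phib k x.
move=> x; rewrite (jump_op_C2 j wC).
have := Papprox _ _ _ _ wC x; rewrite mulrA hn.
set J := jump_part _ _ _ _ => hJ.
have Pw : P w x - Lam * w x = \sum_(k < n) (iter k.+1 N (v (t k)) x - phi k x).
  have -> : P w x = \sum_(k < n) h * P (phi k) x.
    rewrite -(avg_sum HP)//; congr (P _ x); apply/funext => y.
    by rewrite /w mulr_sumr.
  rewrite /w mulrA mulr_sumr -sumrB; apply: eq_bigr => k _.
  by rewrite iterS NE -/(phi k); ring.
have lapw : \sum_i h * \sum_(k < n) iter k N (v2 (t k) i i) x <=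
    \sum_(k < n) (iter k N (v (t k.+1)) x - phi k x + A * h ^+ 2).
  under eq_bigr do rewrite mulr_sumr.
  rewrite exchange_big; apply: ler_sum => k _ /=.
  rewrite -(avg_sum (HNk k))// /phi -(avg_sub (HNk k))// -lerBlDl.
  rewrite -(avg_sub (HNk k)); last 2 first.
  - exact: bl_sum.
  - exact: bl_sub.
  apply: le_trans (ler_norm _) _; rewrite -[leRHS]mul1r.
  apply: (avg_norm (HNk k)) => [|z].
    by apply: bl_sub; [exact: bl_sum|exact: bl_sub].
  have [_ _ _ _] := ht _ _ z (t0 k) h0'.
  by rewrite -tS mulr_sumr distrC.
(* With delta = v_(k+1) - v_k, of size A h, and psi = N^k delta, the left side is psi - N psi = h
   (Lam psi - P psi), and P has mass Lam. *)
have comm k : iter k N (v (t k.+1)) x - phi k x + (iter k.+1 N (v (t k)) x - phi k.+1 x)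
   <= 2 * Lam * A * h ^+ 2.
  set delta := fun z => v (t k.+1) z - v (t k) z.
  have bd : bl delta by exact: bl_sub.
  have dA z : `|delta z| <= A * h.
    by rewrite /delta tS; have [_ _ ? _ _] := ht _ _ z (t0 k) h0'.
  have -> : iter k N (v (t k.+1)) x - phi k x = iter k N delta x.
    by rewrite (avg_sub (HNk k)).
  have -> : iter k.+1 N (v (t k)) x - phi k.+1 x = - iter k.+1 N delta x.
    by rewrite (avg_sub (HNk k.+1))// opprB.
  rewrite iterS NE; set psi := iter k N delta.
  have bpsi : bl psi by exact: (avg_bl (HNk k)).
  have psiA z : `|psi z| <= A * h.
    by rewrite -[leRHS]mul1r; exact: (avg_norm (HNk k)).
  have := avg_norm HP x bpsi psiA; have := psiA x.
  rewrite !ler_norml => /andP[_ p1] /andP[p2 _].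
  have p3 := ler_wpM2l Lam0 p1.
  have p4 : Lam * psi x - P psi x <= 2 * Lam * A * h by lra.
  have p5 := ler_wpM2l h0' p4.
  have -> : psi x - (psi x + h * (P psi x - Lam * psi x)) =
    h * (Lam * psi x - P psi x) by ring.
  by apply: le_trans p5 _; rewrite le_eqVlt; apply/orP; left; apply/eqP; ring.
have tele : \sum_(k < n) (phi k.+1 x - phi k x) = phi n x - v 0 x.
  rewrite -(big_mkord xpredT (fun k => phi k.+1 x - phi k x)) telescope_sumr//.
  by rewrite /phi /t mulr0.
have phin : phi n x <= b T by rewrite -hn; have /andP[] := phib n x.
have hsum : \sum_(k < n) (iter k N (v (t k.+1)) x - phi k x + A * h ^+ 2) +
  \sum_(k < n) (iter k.+1 N (v (t k)) x - phi k x) <= phi n x - v 0 x + e / 2.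
  rewrite -tele -big_split/=.
  apply: (@le_trans _ _ (\sum_(k < n)
    (phi k.+1 x - phi k x + (1 + 2 * Lam) * A * h ^+ 2))).
    apply: ler_sum => k _; have /= := comm k; lra.
  rewrite big_split/= lerD2l sumr_const card_ord -[leLHS]mulr_natr.
  apply: le_trans herr; rewrite -[in leRHS]hn le_eqVlt; apply/orP; left; apply/eqP; ring.
have he1 : T * A * e1 <= e / 2.
  rewrite /e1 mulrA ler_pdivrMr// mulrC ler_wpM2l//; last by rewrite lerDl.
  by rewrite divr_ge0// ltW.
lra.
Qed.
End supersolution.

(** * Integrals of the heat kernel *)

(** Tonelli, by induction along the construction of [lebesgue_rV] as an image of product
    measures. *)
Lemma integral_prod_rV (R : realType) d (phi : 'I_d -> R -> R) :
  (forall i, measurable_fun [set: R] (phi i)) -> (forall i z, 0 <= phi i z) ->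
  (\int[lebesgue_rV d]_y (\prod_i phi i (y 0 i))%:E =
   \prod_i \int[lebesgue_measure]_z (phi i z)%:E)%E.
Proof.
have mprod n (psi : 'I_n -> R -> R) : (forall i, measurable_fun [set: R] (psi i)) ->
    measurable_fun [set: 'rV[R]_n] (fun y => (\prod_i psi i (y 0 i))%:E).
  move=> mpsi; apply/measurable_EFinP; apply: measurable_prod => i _.
  exact: measurableT_comp (mpsi i) (measurable_coord i).
elim: d phi => [|d IH] phi mphi phi0.
  rewrite big_ord0 /= integral_dirac//; last exact: mprod.
  by rewrite diracE in_setT mul1e big_ord0.
rewrite big_ord_recl -IH//.
have -> : (\int[lebesgue_rV d.+1]_y (\prod_i phi i (y 0 i))%:E =
  \int[pushforward (lebesgue_measure \x lebesgue_rV d)%E (@cons_rV R d)]_y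
    (\prod_i phi i (y 0 i))%:E)%E.
  exact: erefl.
rewrite ge0_integral_pushforward//; last 3 first.
- exact: measurable_cons_rV.
- exact: mprod.
- by move=> y _; rewrite lee_fin prodr_ge0.
rewrite preimage_setT.
have E (z : R) (y : 'rV[R]_d) : \prod_i phi i (cons_rV (z, y) 0 i) =
    phi ord0 z * \prod_i phi (lift ord0 i) (y 0 i).
  rewrite big_ord_recl /cons_rV !mxE unlift_none/=; congr (_ * _).
  by apply: eq_bigr => i _; rewrite !mxE liftK.
rewrite fubini_tonelli1; last 2 first.
- apply: measurableT_comp; first exact: mprod.
  exact: measurable_cons_rV.
- by move=> [z y] /=; rewrite lee_fin prodr_ge0.
set K := (\int[lebesgue_rV d]_y _)%E.
have E2 z : (\int[lebesgue_rV d]_y (\prod_i phi i (cons_rV (z, y) 0 i))%:E =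
    (phi ord0 z)%:E * K)%E.
  under eq_integral do rewrite E EFinM.
  rewrite ge0_integralZl//.
  - by apply: (mprod _ (fun i => phi (lift ord0 i))) => i.
  - by move=> y _; rewrite lee_fin prodr_ge0.
  - by rewrite lee_fin.
rewrite /fubini_F/=; under eq_integral do rewrite E2.
rewrite ge0_integralZr//.
- by apply/measurable_EFinP; exact: mphi.
- by move=> z _; rewrite lee_fin.
- by apply: integral_ge0 => y _; rewrite lee_fin prodr_ge0.
Qed.

Section gauss_integral.
Context {R : realType}.
Implicit Types t x z r : R.

(** As the normal density of mean x and variance 2t, [gauss] inherits its total mass and
    measurability. *)
Lemma gauss_normal_pdf t x z : 0 < t ->
  gauss t (x - z) = normal_pdf x (Num.sqrt (2 * t)) z.
Proof.
move=> t0; have t20 : 0 < 2 * t by rewrite mulr_gt0.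
rewrite normal_pdfE ?sqrtr_eq0 -?ltNge// /normal_peak /normal_fun sqr_sqrtr ?ltW//.
rewrite /gauss expRD mulrA mulrAC; congr (_ * _); last first.
  congr expR; rewrite -mulNr -[X in - X ^+ 2]opprB sqrrN.
  by congr (_ / _); ring.
have -> : 2 * t * pi *+ 2 = (4 * pi) * t :> R by ring.
rewrite (sqrtrM t) ?mulr_ge0 ?pi_ge0// invfM; congr (_ * _).
rewrite expRN; congr (_^-1).
by rewrite -powR12_sqrt ?(ltW t0)// /powR gt_eqF// mulrC.
Qed.

Lemma integral_gauss t x : 0 < t -> (\int[lebesgue_measure]_z (gauss t (x - z))%:E = 1)%E.
Proof.
move=> t0; under eq_integral do rewrite gauss_normal_pdf//.
by rewrite integral_normal_pdf// sqrtr_eq0 -ltNge mulr_gt0.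
Qed.

Lemma measurable_gauss t x : 0 < t -> measurable_fun [set: R] (fun z => gauss t (x - z)).
Proof.
move=> t0; under eq_fun do rewrite gauss_normal_pdf//.
exact: measurable_normal_pdf.
Qed.

(* Half of the exponent yields the small factor, the other half [gauss (2 * t)]. *)
Lemma gauss_tail t r z : 0 < t -> 0 < r -> r <= `|z| ->
  gauss t z <= 16 * t / r ^+ 2 * gauss (2 * t) z.
Proof.
move=> t0 r0 rz; rewrite /gauss mulrCA ler_wpM2l ?invr_ge0//.
have r20 : 0 < r ^+ 2 by rewrite exprn_gt0.
have -> : - (z ^+ 2 / (4 * t)) - ln t / 2 = - (z ^+ 2 / (8 * t)) + ln 2 / 2 +
   (- (z ^+ 2 / (4 * (2 * t))) - ln (2 * t) / 2).
  by rewrite lnM ?posrE//; field; rewrite gt_eqF.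
rewrite expRD ler_wpM2r ?expR_ge0//.
(* The factor 2 bounds exp(ln 2 / 2), the price of passing from t to 2t in the normalization. *)
have -> : 16 * t / r ^+ 2 = (r ^+ 2 / (8 * t))^-1 * 2 by field; rewrite !gt_eqF.
rewrite expRD ler_pM ?expR_ge0//; last first.
  rewrite -[leRHS](@lnK R) ?posrE// ler_expR ler_piMr ?ln_ge0 ?ler1n//.
  by rewrite invf_le1// ler1n.
have rz2 : r ^+ 2 <= z ^+ 2 by rewrite -(real_normK (num_real z)) ler_pXn2r ?nnegrE// ltW.
rewrite expRN lef_pV2 ?posrE ?expR_gt0 ?divr_gt0 ?mulr_gt0//.
apply: le_trans (expR_ge1Dx _); apply: (@le_trans _ _ (z ^+ 2 / (8 * t))).
  by rewrite ler_wpM2r// invr_ge0 mulr_ge0// ltW.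
by rewrite lerDr.
Qed.

(** By [gauss_tail] the mass outside the interval is at most 16 t / r^2 times the total mass 1 of
    [gauss (2 * t)]. *)
Lemma integral_gauss_ball t x r : 0 < t -> 0 < r ->
  ((1 - 16 * t / r ^+ 2)%:E <=
   \int[lebesgue_measure]_z ((if (`|x - z| < r)%R then gauss t (x - z) else 0)%:E))%E.
Proof.
move=> t0 r0.
have t20 : 0 < 2 * t by rewrite mulr_gt0.
set I := integral _ _ _.
have mif : measurable_fun [set: R]
    (fun z => if (`|x - z| < r)%R then gauss t (x - z) else 0).
  apply: measurable_fun_ifT => //; last exact: measurable_gauss.
  apply: measurable_fun_ltr => //.
  by apply: measurableT_comp => //; exact: measurable_funB.
suff : (1 <= I + (16 * t / r ^+ 2)%:E)%E.
  by rewrite EFinB leeBlDr.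
rewrite -(integral_gauss x t0) -[X in (_ <= _ + X)%E]mule1 -(integral_gauss x t20).
rewrite -ge0_integralZl//; last 3 first.
- by apply/measurable_EFinP; exact: measurable_gauss.
- by move=> z _; rewrite lee_fin ltW// gauss_gt0.
- by rewrite lee_fin divr_ge0 ?mulr_ge0 ?exprn_ge0// ltW.
rewrite -ge0_integralD//; last 4 first.
- by move=> z _; rewrite lee_fin; case: ifP => // _; rewrite ltW// gauss_gt0.
- exact/measurable_EFinP.
- by move=> z _; rewrite lee_fin mulr_ge0 ?divr_ge0 ?mulr_ge0 ?exprn_ge0 ?(ltW t0)
    ?(ltW r0) ?(ltW (gauss_gt0 _ _)).
- by apply/measurable_EFinP; apply: measurable_funM => //; exact: measurable_gauss.
apply: ge0_le_integral => //.
- by move=> z _; rewrite lee_fin ltW// gauss_gt0.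
- by apply/measurable_EFinP; exact: measurable_gauss.
- apply/measurable_EFinP; apply: measurable_funD => //.
  by apply: measurable_funM => //; exact: measurable_gauss.
move=> z _; rewrite lee_fin; case: ifPn => [_|].
  by rewrite lerDl mulr_ge0 ?divr_ge0 ?mulr_ge0 ?exprn_ge0 ?(ltW t0)
    ?(ltW r0) ?(ltW (gauss_gt0 _ _)).
by rewrite -leNgt add0r => zr; exact: gauss_tail.
Qed.

End gauss_integral.

(** * Power inequalities and the sum over time of the decay rate *)

Section powers.
Context {R : realType}.
Implicit Types a b p s T : R.

(* Either [G <= M], or [M < G] and [G = G^(1-p) G^p <= M^(1-p) G^p]. *)
Lemma le_add_powR p G M : 1 <= p -> 0 <= G -> 0 < M ->
  G <= M + M `^ (1 - p) * G `^ p.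
Proof.
move=> p1 G0 M0; have [GM|MG] := leP G M.
  by rewrite (le_trans GM)// lerDl mulr_ge0 ?powR_ge0.
have G_gt0 := lt_trans M0 MG.
apply: (@le_trans _ _ (M `^ (1 - p) * G `^ p)); last by rewrite lerDr ltW.
have {1}-> : G = G `^ (1 - p) * G `^ p.
  by rewrite -powRD ?subrK ?powRr1// gt_eqF// implybT.
rewrite ler_wpM2r ?powR_ge0// -opprB !powRN lef_pV2 ?posrE ?powR_gt0//.
by rewrite ge0_ler_powR ?nnegrE ?subr_ge0// ltW.
Qed.

(** The tangent bound for the concave power 1 - beta, taken at b. It is Young's inequality for the
    product of (a/b)^(1-beta) and 1, which also covers a = 0, where the power is not
    differentiable. *)
Lemma powR_step beta a b : 0 < beta < 1 -> 0 <= a -> 0 < b ->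
  (1 - beta) * ((b - a) * expR (- beta * ln b)) <= b `^ (1 - beta) - a `^ (1 - beta).
Proof.
move=> /andP[beta0 beta1] a0 b0; set al := 1 - beta.
have al0 : 0 < al by rewrite subr_gt0.
set q := expR (- beta * ln b).
have bq : b `^ al = b * q.
  rewrite /powR gt_eqF// -{2}(@lnK _ b) ?posrE// -expRD; congr expR; rewrite /al; ring.
have yng : (a / b) `^ al <= al * (a / b) + beta.
  have := @conjugate_powR R ((a / b) `^ al) 1 al^-1 beta^-1.
  rewrite !invrK mulr1 powR1 mul1r -powRrM mulfV ?gt_eqF// powRr1 ?divr_ge0 ?(ltW b0)//.
  rewrite (mulrC al); apply => //; rewrite ?powR_ge0 ?invr_gt0//.
  by rewrite /al subrK.
have -> : a `^ al = (a / b) `^ al * b `^ al.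
  by rewrite -powRM ?divr_ge0 ?(ltW b0)// divfK// gt_eqF.
have := ler_wpM2r (powR_ge0 b al) yng.
have -> : (al * (a / b) + beta) * b `^ al = (al * a + beta * b) * q.
  by rewrite bq; field; rewrite gt_eqF.
rewrite bq /al; lra.
Qed.

(** As h <= s, the time s + hk is at least h(k+1), so each term is dominated by an increment of
    t^(1-beta) / (1-beta) and the sum telescopes. The bound no longer depends on s. *)
Lemma sum_decay beta s T n : 0 < beta < 1 -> 0 < T -> (0 < n)%N -> T / n%:R <= s ->
  T / n%:R * \sum_(k < n) expR (- beta * ln (s + T / n%:R * k%:R)) <=
  T `^ (1 - beta) / (1 - beta).
Proof.
move=> hb T0 n0 hs; have /andP[beta0 beta1] := hb.
have al0 : 0 < 1 - beta by rewrite subr_gt0.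
set h := T / n%:R in hs *; have h0 : 0 < h by rewrite divr_gt0// ltr0n.
have hn : h * n%:R = T by rewrite divfK// pnatr_eq0 -lt0n.
rewrite ler_pdivlMr// mulrC !mulr_sumr.
apply: (@le_trans _ _ (\sum_(k < n)
  ((h * k.+1%:R) `^ (1 - beta) - (h * k%:R) `^ (1 - beta)))).
  apply: ler_sum => k _.
  have hk0 : 0 < h * k.+1%:R by rewrite mulr_gt0// ltr0n.
  have hk1 : 0 <= h * k%:R by rewrite mulr_ge0// ltW.
  apply: le_trans (powR_step hb hk1 hk0); rewrite ler_wpM2l ?(ltW al0)//.
  have hkS : h * k.+1%:R = h + h * k%:R by rewrite mulrSr mulrDr mulr1 addrC.
  rewrite {1}hkS addrK ler_wpM2l ?(ltW h0)// ler_expR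
    !mulNr lerN2 ler_wpM2l ?(ltW beta0)//.
  have hsk : h * k.+1%:R <= s + h * k%:R by rewrite hkS lerD2r.
  by rewrite ler_ln ?posrE// (lt_le_trans hk0).
rewrite -(big_mkord xpredT
  (fun k => (h * k.+1%:R) `^ (1 - beta) - (h * k%:R) `^ (1 - beta))).
rewrite (telescope_sumr (fun k => (h * k%:R) `^ (1 - beta)))// mulr0 hn powR0 ?subr0//.
by rewrite gt_eqF.
Qed.

End powers.

Section kernel_integral.
Context {R : realType} {d : nat}.
Local Notation V := 'rV[R]_d.
Local Notation mu := (@lebesgue_rV R d).
Local Notation m0 := (fun=> 0%N).
Implicit Types (x y : V) (t r : R).

Lemma kap_mass t x : 0 < t -> (\int[mu]_y (kap m0 t (x - y))%:E = 1)%E.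
Proof.
move=> t0; under eq_integral => y _.
  rewrite kapE; under eq_bigr do rewrite !mxE.
  over.
rewrite (integral_prod_rV (phi := fun i z => gauss t (x 0 i - z))).
- by rewrite big1// => i _; exact: integral_gauss.
- by move=> i; exact: measurable_gauss.
- by move=> i z; exact/ltW/gauss_gt0.
Qed.

(** A sup-norm ball is a product of intervals, so the mass is a product of d factors at least 1 -
    eta; Bernoulli's inequality concludes. *)
Lemma kap_ball t x r : 0 < t -> 0 < r -> 16 * t / r ^+ 2 <= 1 ->
  ((1 - d%:R * (16 * t / r ^+ 2))%:E <=
   \int[mu]_y (if `[< ball x r y >] then kap m0 t (x - y) else 0)%:E)%E.
Proof.
move=> t0 r0; set eta := 16 * t / r ^+ 2 => eta1.
have eta0 : 0 <= eta by rewrite divr_ge0 ?mulr_ge0 ?exprn_ge0// ltW.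
pose phi i (z : R) := if `|x 0 i - z| < r then gauss t (x 0 i - z) else 0.
have phi0 i z : 0 <= phi i z by rewrite /phi; case: ifP => // _; exact/ltW/gauss_gt0.
have -> : (\int[mu]_y (if `[< ball x r y >] then kap m0 t (x - y) else 0)%:E =
   \int[mu]_y (\prod_i phi i (y 0 i))%:E)%E.
  apply: eq_integral => y _; congr EFin; case: ifPn => /asboolP bxy.
    rewrite kapE; apply: eq_bigr => i _; rewrite !mxE /phi.
    by have /(ball_rVP _ _ r0)/(_ i) -> := bxy.
  have [i /negP xyi] : exists i, ~ `|x 0 i - y 0 i| < r.
    apply/not_existsP => h; apply: bxy; apply/(ball_rVP _ _ r0) => i.
    exact: contrapT (h i).
  by rewrite (bigD1 i)//= /phi (negPf xyi) mul0r.
rewrite integral_prod_rV//; last first.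
  move=> i; apply: measurable_fun_ifT => //; last exact: measurable_gauss.
  apply: measurable_fun_ltr => //.
  by apply: measurableT_comp => //; exact: measurable_funB.
have bern n : 1 - n%:R * eta <= (1 - eta) ^+ n.
  elim: n => [|n IH]; first by rewrite mul0r subr0 expr0.
  rewrite exprS; apply: (@le_trans _ _ ((1 - eta) * (1 - n%:R * eta))).
    have : 0 <= n%:R * eta * eta by exact: mulr_ge0 (mulr_ge0 (ler0n _ _) eta0) eta0.
    rewrite mulrSr; lra.
  by rewrite ler_wpM2l// subr_ge0.
apply: (@le_trans _ _ ((1 - eta) ^+ d)%:E); first by rewrite lee_fin.
have prodE n (I : 'I_n -> \bar R) : (forall i, (1 - eta)%:E <= I i)%E ->
    (((1 - eta) ^+ n)%:E <= \prod_i I i)%E.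
  elim: n I => [|n IH] I hI; first by rewrite big_ord0 expr0.
  rewrite big_ord_recl exprS EFinM lee_pmul ?lee_fin ?exprn_ge0 ?subr_ge0//.
  exact: IH.
by apply: prodE => i; exact: integral_gauss_ball.
Qed.

(** This is (4 pi)^(-d/2), the maximum of the heat kernel at time 1. *)
Definition kpeak : R := ((Num.sqrt (4 * pi))^-1) ^+ d.

Lemma kpeak_ge0 : 0 <= kpeak.
Proof. by rewrite exprn_ge0// invr_ge0. Qed.

Lemma kap_ub t x : 0 < t -> kap m0 t x <= kpeak * expR (- (d%:R / 2) * ln t).
Proof.
move=> t0; rewrite kapE /kpeak.
have -> : expR (- (d%:R / 2) * ln t) = expR (- ln t / 2) ^+ d.
  by rewrite -expRM_natl; congr expR; field.
rewrite -exprMn -[X in _ ^+ X]card_ord -prodr_const.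
apply: ler_prod => i _; rewrite (ltW (gauss_gt0 _ _))/= ler_wpM2l ?invr_ge0//.
have : 0 <= x 0 i ^+ 2 / (4 * t) by rewrite divr_ge0 ?sqr_ge0// mulr_ge0// ltW.
by rewrite ler_expR; lra.
Qed.

End kernel_integral.

(** * The heat flow of a function on D *)

Section potential.
Context {R : realType} {d : nat}.
Local Notation V := 'rV[R]_d.
Local Notation mu := (@lebesgue_rV R d).
Local Notation m0 := (fun=> 0%N).
Implicit Types (x y : V) (t r s : R).

Lemma C2jet_kap s : 0 < s -> exists2 A, 1 <= A & 
  (forall t, s <= t -> C2jet A (kap m0 t) (fun i : 'I_d => kap (addm m0 i) t)
     (fun i k => kap (addm (addm m0 i) k) t)) /\
  (forall t h x, s <= t -> 0 <= h ->
    jet A h (kap m0 t x) (kap m0 (t + h) x)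
      (h * \sum_i kap (addm (addm m0 i) i) t x)).
Proof.
move=> s0; have [A A1 [hx ht]] := @jet_kap R d s s0; exists A => //; split => // t st.
have le1 (i j : 'I_d) : (addm m0 i j <= 1)%N by rewrite /addm add0n; case: (_ == _).
have le2 (i k j : 'I_d) : (addm (addm m0 i) k j <= 2)%N.
  by rewrite /addm add0n; case: (_ == _); case: (_ == _).
split.
- by move=> x y; apply: hx.
- move=> k x y; have h2 i : (addm m0 k i <= 2)%N by rewrite (leq_trans (le1 k i)).
  exact: hx h2 st.
- move=> k i; split => [x|x y].
    by have [] := hx _ t x 0 (le2 k i) st.
  by have [] := hx _ t x y (le2 k i) st.
Qed.

Variables (D : set V) (g : V -> R).
Hypotheses (mD : measurable D) (ig : mu.-integrable D (EFin \o g))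
  (g0 : forall y, D y -> 0 <= g y).

Definition potential (u : V -> R) x := \int[mu]_(y in D) (u (x - y) * g y).

Lemma avg_potential : avg_op (\int[mu]_(y in D) g y) potential.
Proof. exact: (avg_integral mD measurable_rV_opp ig g0). Qed.

(** Supplies the two regularity hypotheses of [supersolution]. The shift by s > 0 is what makes A
    independent of t. *)
Lemma heat_potential s : 0 < s -> exists A,
  (forall t, 0 <= t -> C2jet A (potential (kap m0 (s + t)))
     (fun i => potential (kap (addm m0 i) (s + t)))
     (fun i k => potential (kap (addm (addm m0 i) k) (s + t)))) /\
  (forall t h x, 0 <= t -> 0 <= h ->
    jet A h (potential (kap m0 (s + t)) x) (potential (kap m0 (s + (t + h))) x)
      (h * \sum_i potential (kap (addm (addm m0 i) i) (s + t)) x)).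
Proof.
move=> s0; have [A A1 [hx ht]] := C2jet_kap s0.
exists (\int[mu]_(y in D) g y * A); split.
  by move=> t t0; apply: (avg_C2jet avg_potential); apply: hx; rewrite lerDl.
move=> t h x t0 h0; have st : s <= s + t by rewrite lerDl.
have bk t' : s <= t' -> bl (@kap R d m0 t').
  by move=> /hx/C2jet_blip[? _]; exists A.
have bk2 i k : bl (kap (addm (addm m0 i) k) (s + t) : V -> R).
  by have [_ _ h2] := hx _ st; exists A.
rewrite addrA mulr_sumr -(avg_sum avg_potential)//.
apply: (avg_jet avg_potential) => //.
- exact: bk.
- by apply: bk; rewrite -addrA lerDl addr_ge0.
- exact: bl_sum.
by move=> z; have := ht _ _ z st h0; rewrite mulr_sumr.
Qed.

Lemma bl_kap t : 0 < t -> bl (@kap R d m0 t).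
Proof.
move=> t0; have [A _ [hx _]] := C2jet_kap t0.
by have [? _] := C2jet_blip (hx _ (lexx t)); exists A.
Qed.

Lemma potential_ge0 t x : 0 < t -> 0 <= potential (kap m0 t) x.
Proof.
move=> t0; apply: (avg_ge0 avg_potential); first exact: bl_kap.
exact: kap_ge0.
Qed.

(** Only the part of the integral over the ball is kept, where the kernel has almost full mass. This
    recovers g from the smoothed initial value. *)
Lemma potential_lb t x r a : 0 < t -> 0 < r -> 16 * t / r ^+ 2 <= 1 -> 0 <= a ->
  (forall y, ball x r y -> D y /\ a <= g y) ->
  (1 - d%:R * (16 * t / r ^+ 2)) * a <= potential (kap m0 t) x.
Proof.
move=> t0 r0 hr a0 hb; rewrite -lee_fin /potential /Rintegral.
have iK : mu.-integrable D (EFin \o (fun y => kap m0 t (x - y) * g y)).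
  exact: (@integrable_bl R d D (fun y => - y) g mD measurable_rV_opp ig _ x (bl_kap t0)).
rewrite fineK; last exact: integrable_fin_num.
have mK : measurable_fun [set: V] (fun y => kap m0 t (x - y)).
  exact: measurableT_comp (bl_measurable (bl_kap t0))
    (measurable_rV_add x measurable_rV_opp).
have mB : measurable_fun [set: V]
    (fun y => if `[< ball x r y >] then kap m0 t (x - y) else 0).
  apply: measurable_fun_ifT => //.
  apply: (measurable_fun_bool true); rewrite setTI.
  rewrite (_ : _ @^-1` _ = ball x r); first exact: measurable_ball_rV.
  by apply/seteqP; split => y /=; [move/asboolP|move=> ?; apply/asboolP].
rewrite mulrC EFinM.
apply: (le_trans (lee_wpmul2l _ (kap_ball x t0 r0 hr))); first by rewrite lee_fin.
rewrite -ge0_integralZl//; last 2 first.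
- exact/measurable_EFinP.
- by move=> y _; rewrite lee_fin; case: ifP => // _; exact: kap_ge0.
rewrite [leRHS]integral_mkcond; apply: ge0_le_integral => //.
- move=> y _; rewrite lee_fin mulr_ge0//; case: ifP => // _; exact: kap_ge0.
- by apply/measurable_EFinP; exact: measurable_funM.
- by apply/(measurable_restrictT _ mD); exact: measurable_int iK.
move=> y _; case: ifPn => [/asboolP bxy|_].
  have [Dy ay] := hb _ bxy.
  by rewrite patchT ?inE//= lee_fin mulrC ler_wpM2l// kap_ge0.
rewrite mule0 /patch; case: ifPn => // /set_mem Dy /=.
by rewrite lee_fin mulr_ge0 ?g0// kap_ge0.
Qed.

End potential.

Section potential_ub.
Context {R : realType} {d : nat}.
Local Notation V := 'rV[R]_d.
Local Notation mu := (@lebesgue_rV R d).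
Local Notation m0 := (fun=> 0%N).
Implicit Types (x y : V) (t r s : R).
Variables (D : set V) (G : V -> R) (W B F0 p M1 : R).
Hypotheses (mD : measurable D) (DW : (mu D <= W%:E)%E) (mG : measurable_fun D G)
  (G0 : forall y, D y -> 0 <= G y <= F0) (M10 : 0 <= M1) (p1 : 1 <= p) (B0 : 0 < B)
  (GB : \int[mu]_(y in D) (G y `^ p) <= B `^ p).

Lemma finite_D : (mu D < +oo)%E.
Proof. exact: le_lt_trans DW (ltry _). Qed.

Lemma integrable_bounded (F : V -> R) C : measurable_fun D F ->
  (forall y, D y -> `|F y| <= C) -> mu.-integrable D (EFin \o F).
Proof.
move=> mF FC; apply: measurable_bounded_integrable => //; first exact: finite_D.
exists C; split; rewrite ?num_real// => x Cx y Dy /=.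
by rewrite (le_trans (FC _ Dy))// ltW.
Qed.

Lemma integrable_G : mu.-integrable D (EFin \o (fun y => G y + M1)).
Proof.
apply: (integrable_bounded (C := F0 + M1)); first exact: measurable_funD.
move=> y /G0/andP[h1 h2]; rewrite ger0_norm ?addr_ge0//; lra.
Qed.

(** Hölder's inequality in disguise: [le_add_powR] splits G at the level m. The term m is integrated
    against a kernel of mass at most 1, the term with G^p against the peak of the kernel. For [M1],
    either the mass of the kernel or its peak times the volume is used. *)
Lemma potential_ub t x : 0 < t ->
  potential D (fun y => G y + M1) (kap m0 t) x <=
  (1 + @kpeak R d) * B * expR (- (d%:R / (2 * p)) * ln t) +
  M1 * Num.min 1 (@kpeak R d * W * expR (- (d%:R / 2) * ln t)).
Proof.
move=> t0; set beta := d%:R / (2 * p); set E := expR (- (d%:R / 2) * ln t).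
set pk := @kpeak R d; have pk0 : 0 <= pk := kpeak_ge0.
have p0 : 0 < p by exact: lt_le_trans p1.
have E0 : 0 <= E by exact: expR_ge0.
(* This level balances both terms: m^(1-p) t^(-d/2) B^p = m. *)
set m := B * expR (- beta * ln t).
have m_gt0 : 0 < m by rewrite mulr_gt0// expR_gt0.
pose K y := kap m0 t (x - y).
have K0 y : 0 <= K y by exact: kap_ge0.
have KE y : K y <= pk * E by exact: kap_ub.
have mK : measurable_fun [set: V] K.
  exact: measurableT_comp (bl_measurable (bl_kap t0))
    (measurable_rV_add x measurable_rV_opp).
have mKD : measurable_fun D K by exact: measurable_funS mK.
have iK : mu.-integrable D (EFin \o K).
  by apply: (integrable_bounded (C := pk * E)) => // y _; rewrite ger0_norm.
have iGp : mu.-integrable D (EFin \o (fun y => G y `^ p)).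
  apply: (integrable_bounded (C := F0 `^ p)).
    exact: measurableT_comp (measurable_powR p) mG.
  move=> y /G0/andP[h1 h2]; rewrite ger0_norm ?powR_ge0//.
  rewrite ge0_ler_powR ?nnegrE ?(ltW p0)//.
  exact: le_trans h2.
have K1 : \int[mu]_(y in D) K y <= 1.
  rewrite -lee_fin /Rintegral fineK; last exact: integrable_fin_num.
  rewrite -(kap_mass x t0); apply: ge0_subset_integral => //.
  - exact/measurable_EFinP.
  - by move=> y _; rewrite lee_fin K0.
have K2 : \int[mu]_(y in D) K y <= pk * W * E.
  apply: (@le_trans _ _ (\int[mu]_(y in D) (pk * E))).
    apply: le_Rintegral => //.
    by apply: (integrable_bounded (C := pk * E)) => // y _; rewrite ger0_norm ?mulr_ge0.
  rewrite Rintegral_cst// [leRHS]mulrAC ler_wpM2l ?mulr_ge0//.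
  by rewrite -lee_fin fineK// ge0_fin_numE ?measure_ge0 ?finite_D.
have iKK := integrableZl mD (m + M1) iK.
have iGG := integrableZl mD (m `^ (1 - p) * (pk * E)) iGp.
have iL : mu.-integrable D (EFin \o (fun y => K y * (G y + M1))).
  exact: (@integrable_bl R d D (fun y => - y) _ mD measurable_rV_opp
    integrable_G _ x (bl_kap t0)).
have le1 : \int[mu]_(y in D) (K y * (G y + M1)) <=
    \int[mu]_(y in D) ((m + M1) * K y + m `^ (1 - p) * (pk * E) * G y `^ p).
  apply: le_Rintegral => //; first exact: (integrableD mD iKK iGG).
  move=> y Dy; have /andP[Gy0 _] := G0 Dy.
  have h1 := ler_wpM2l (K0 y) (le_add_powR p1 Gy0 m_gt0).
  have h2 := ler_wpM2r (mulr_ge0 (powR_ge0 m (1 - p)) (powR_ge0 (G y) p)) (KE y).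
  lra.
apply: le_trans le1 _; rewrite RintegralD// !RintegralZl//.
have hm : m `^ (1 - p) * (pk * E) * B `^ p = pk * m.
  rewrite /m /E powRM ?expR_ge0 ?(ltW B0)//.
  have -> : B `^ (1 - p) * expR (- beta * ln t) `^ (1 - p) *
      (pk * expR (- (d%:R / 2) * ln t)) * B `^ p =
      pk * ((B `^ (1 - p) * B `^ p) *
        (expR (- beta * ln t) `^ (1 - p) * expR (- (d%:R / 2) * ln t))) by ring.
  congr (_ * (_ * _)).
    by rewrite -powRD ?subrK ?powRr1 ?(ltW B0)// gt_eqF// implybT.
  rewrite /powR gt_eqF ?expR_gt0// expRK -expRD; congr expR.
  by rewrite /beta; field; rewrite gt_eqF.
have h1 : m `^ (1 - p) * (pk * E) * \int[mu]_(y in D) (G y `^ p) <= pk * m.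
  rewrite -hm; apply: ler_wpM2l => //.
  exact: mulr_ge0 (powR_ge0 _ _) (mulr_ge0 pk0 E0).
have h2 : m * \int[mu]_(y in D) K y <= m by rewrite ler_piMr// ltW.
have h3 : M1 * \int[mu]_(y in D) K y <= M1 * Num.min 1 (pk * W * E).
  by rewrite ler_wpM2l// le_min K1 K2.
have -> : (1 + pk) * B * expR (- beta * ln t) = m + pk * m by rewrite /m; ring.
lra.
Qed.

End potential_ub.

(** * The maximum principle *)

Section comparison.
Context {R : realType} {d : nat}.
Local Notation V := 'rV[R]_d.
Local Notation mu := (@lebesgue_rV R d).
Implicit Types (x y z : V) (u w : V -> R) (D K : set V).

Lemma C2jet_addc A c u (u1 : 'I_d -> V -> R) (u2 : 'I_d -> 'I_d -> V -> R) :
  C2jet A u u1 u2 -> C2jet (A + `|c|) (fun z => u z + c) u1 u2.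
Proof.
move=> h; have A0 : 0 <= A by have [/blip_ge0] := C2jet_blip h.
have AA : A <= A + `|c| by rewrite lerDl.
have [h1 h2 h3] := h; split.
- move=> x y; have [j1 j2 j3 j4 j5] := jet_le (normr_ge0 y) AA (h1 x y).
  have [i1 i2 _ _ _] := h1 x y.
  have -> : jet (A + `|c|) `|y| (u x + c) (u (x + y) + c) (\sum_i y 0 i * u1 i x) =
    [/\ `|u x + c| <= A + `|c|, `|u (x + y) + c| <= A + `|c|,
        `|u (x + y) - u x| <= (A + `|c|) * `|y|,
        `|\sum_i y 0 i * u1 i x| <= (A + `|c|) * `|y| &
        `|u (x + y) - u x - \sum_i y 0 i * u1 i x| <= (A + `|c|) * `|y| ^+ 2].
    by rewrite /jet opprD addrACA subrr addr0.
  split => //.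
    by rewrite (le_trans (ler_normD _ _))// lerD2r.
  by rewrite (le_trans (ler_normD _ _))// lerD2r.
- by move=> k x y; exact: jet_le (h2 k x y).
- move=> k i; have [b1 b2] := h3 k i; split => [x|x y].
    exact: le_trans AA.
  by apply: le_trans (b2 x y) _; rewrite ler_wpM2r.
Qed.

(** Otherwise u - w has a maximum c > e over the compact set {e <= u}. Then w + c lies above u
    everywhere, since outside that set u < e < c <= w + c, and it touches u at the maximum point,
    which lies in G. Testing there, with G itself as neighbourhood, gives - f <= L w, against the
    strict inequality. Cutting at e > 0 makes the set closed and keeps it inside {u > 0}. *)
Lemma comparison (j : V -> R) D f u A w (w1 : 'I_d -> V -> R)
    (w2 : 'I_d -> 'I_d -> V -> R) (e : R) :
  jump_kernel j -> open D -> continuous u -> bounded_fun u ->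
  viscosity_subsolution j ([set x | 0 < u x] `&` D) u (fun x => - f x) ->
  (forall x, ~ D x -> u x <= 0) -> 0 < e -> compact [set x | e <= u x] ->
  C2jet A w w1 w2 -> (forall x, 0 <= w x) ->
  (forall x, e <= u x -> jump_op j w x < - f x) ->
  forall x, u x <= w x + e.
Proof.
move=> hj oD cu [B [_ uB]] [_ _ visc] uD e0 cK hw w0 hlt x1.
rewrite leNgt; apply/negP => x1lt.
have wbl : bl w by have [? _] := C2jet_blip hw; exists A.
have x1K : e <= u x1 by rewrite ltW// (le_lt_trans _ x1lt)// lerDr.
have cuw : continuous (fun z => u z - w z).
  by move=> z; exact: (continuousB (cu z) (bl_continuous wbl (x := z))).
have [x0 x0K x0max] := compact_EVT_max (ex_intro _ x1 x1K) cK (continuous_subspaceT cuw).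
have {}x0K : e <= u x0 by move: x0K; rewrite inE.
set c := u x0 - w x0 in x0max.
have cx1 : u x1 - w x1 <= c by apply: x0max; rewrite inE.
have ce : e < c by apply: lt_le_trans cx1; rewrite ltrBrDl.
have ule z : u z <= w z + c.
  have [zK|zK] := leP e (u z).
    by rewrite -lerBlDl; apply: x0max; rewrite inE.
  by rewrite (le_trans (ltW zK))// (le_trans (ltW ce))// lerDr.
have hphi := C2jet_addc c hw.
pose G := [set x | 0 < u x] `&` D.
have oG : open G.
  apply: openI => //; rewrite (_ : [set x | _] = u @^-1` [set r | 0 < r])//.
  apply: open_comp; last exact: open_gt.
  by move=> z _; exact: cu.
have ux0 : 0 < u x0 by exact: lt_le_trans x0K.
have Dx0 : D x0 by apply: contrapT => /uD; rewrite leNgt ux0.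
have Gx0 : G x0 by [].
have := visc x0 G (fun z => w z + c) Gx0 oG Gx0 (fun _ h => h) (C2jet_closure hphi G).
move=> /(_ _ (fun y _ => ule y)); rewrite /c addrC subrK => /(_ erefl) h1.
have uB' z : `|u z| <= B + 1 by apply: (uB (B + 1)) => //; rewrite ltrDl.
have h2 := jump_op_patch hj hphi cu uB' oG Gx0 ule.
have := le_trans h1 h2.
rewrite (jump_op_C2 j hphi) leNgt => /negP; apply.
have := hlt _ x0K; rewrite (jump_op_C2 j hw).
congr (_ + _ < _); apply: eq_Rintegral => y _.
by rewrite [w x0 + _]addrC opprD addrACA addrA; congr (_ * _); ring.
Qed.

End comparison.

Section domain.
Context {R : realType} {d : nat}.
Local Notation V := 'rV[R]_d.
Local Notation mu := (@lebesgue_rV R d).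
Implicit Types (x y z : V) (D K : set V) (f : V -> R).

Lemma enorm_le z : enorm z <= d%:R * `|z|.
Proof.
have dz0 : 0 <= d%:R * `|z| by rewrite mulr_ge0.
rewrite -(ger0_norm dz0) -sqrtr_sqr ler_wsqrtr// exprMn.
apply: (@le_trans _ _ (\sum_(i < d) `|z| ^+ 2)).
  apply: ler_sum => i _; rewrite -expr2 -(real_normK (num_real (z 0 i))).
  by rewrite ler_pXn2r ?nnegrE// coord_norm_le.
rewrite sumr_const card_ord -[leLHS]mulr_natl ler_wpM2r ?sqr_ge0//.
by rewrite expr2 -natrM ler_nat; case: d => // n; rewrite leq_pmulr.
Qed.

Lemma le_diam D x y : bounded_set D -> D x -> D y -> enorm (x - y) <= diam D.
Proof.
move=> [M [_ DM]] Dx Dy; apply: ub_le_sup; last by exists x => //; exists y.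
have DM' z : D z -> `|z| <= M + 1 by apply: DM; rewrite ltrDl.
exists (d%:R * (M + 1 + (M + 1))) => _ [a Da [b Db <-]].
apply: le_trans (enorm_le _) _; rewrite ler_wpM2l//.
by apply: le_trans (ler_normB _ _) _; rewrite lerD ?DM'.
Qed.

(** D lies in the cube of side 2 diam D centred at any of its points. The absolute value settles the
    sign when D is empty. *)
Lemma volume_le D : open D -> bounded_set D ->
  (mu D <= ((2 * `|diam D|) ^+ d)%:E)%E.
Proof.
move=> oD bD; have [->|/set0P[a Da]] := eqVneq D set0.
  by rewrite measure0 lee_fin exprn_ge0// mulr_ge0.
set del := diam D.
have del0 : 0 <= del by apply: le_trans (le_diam bD Da Da); exact: enorm_ge0.
rewrite (ger0_norm del0).
pose I (i : 'I_d) : set (measurableTypeR R) := `[a 0 i - del, a 0 i + del]%classic.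
have mI i : measurable (I i) by exact: measurable_itv.
apply: (@le_trans _ _ (mu [set x : V | forall i, I i (x 0 i)])).
  apply: le_measure; rewrite ?inE.
  - exact: measurable_open_rV.
  - rewrite (_ : [set x | _] =
      \bigcap_(i in [set: 'I_d]) ((fun x : V => x 0 i) @^-1` I i)).
      apply: fin_bigcap_measurable => // i _.
      by rewrite -[X in measurable X]setTI; exact: measurable_coord.
    by apply/seteqP; split => [x Ix i _|x Ix i]; [exact: Ix|exact: (Ix i Logic.I)].
  - move=> x Dx i; rewrite /I/= in_itv/=.
    have := le_trans (coord_le_enorm (x - a) i) (le_diam bD Dx Da).
    by rewrite !mxE ler_norml -/del; lra.
rewrite lebesgue_rV_box// (eq_bigr (fun=> (2 * del)%:E)); last first.
  move=> i _; rewrite /I lebesgue_measure_itv/= lte_fin.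
  case: ifPn => [_|]; first by rewrite -EFinB; congr EFin; ring.
  by rewrite -leNgt => h; congr EFin; lra.
rewrite (_ : (\prod_(i < d) _)%E = ((2 * del) ^+ d)%:E)//.
rewrite -[in RHS](card_ord d) -prodr_const.
by elim/big_rec2: _ => // i x y _ ->; rewrite EFinM.
Qed.

Lemma measurable_within_continuous D f : open D -> {within D, continuous f} ->
  measurable_fun D f.
Proof.
move=> oD; rewrite continuous_open_subspace// => cf.
apply: (measurability _ (RGenOInfty.measurableE R)) => _ [_ [a ->] <-].
apply: measurable_open_rV; rewrite openE => x [Dx fx]; rewrite /interior.
apply: filterI; first exact: open_nbhs_nbhs.
apply: (cf x (mem_set Dx)); apply: open_nbhs_nbhs; split => //.
Qed.

(** Compactness provides one radius, hence one initial time s, with which [potential_lb] applies at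
    all points of K. *)
Lemma uniform_radius D K f e : open D -> {within D, continuous f} -> compact K ->
  K `<=` D -> 0 < e ->
  exists2 r : R, 0 < r & forall x y, K x -> ball x r y ->
    D y /\ Num.max (f x) 0 - e <= Num.max (f y) 0.
Proof.
move=> oD; rewrite continuous_open_subspace// => cf cK KD e0.
have e20 : 0 < e / 2 by rewrite divr_gt0.
pose P (r : R) x := forall y, ball x r y -> D y /\ Num.max (f x) 0 - e <= Num.max (f y) 0.
have /compact_near_coveringP/(_ _ (0^'+) P _) := cK.
case=> [x Kx|r0 /= r00 hr0].
  have Dx := KD _ Kx.
  have h1 : \forall y \near x, D y /\ `|f x - f y| < e / 2.
    apply: filterI; first exact: open_nbhs_nbhs.
    by have /cvgrPdist_lt/(_ _ e20) := cf x (mem_set Dx).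
  have /nbhs_ballP[r /= r0 hr] := h1.
  have r20 : 0 < r / 2 by rewrite divr_gt0.
  exists (ball x (r / 2), [set t | t < r / 2]).
    by split => /=; [exact: nbhsx_ballx|exact: nbhs_right_lt].
  move=> [x' t] [/= xx' tr] y x'y.
  have [Dx' fx'] : D x' /\ `|f x - f x'| < e / 2.
    by apply: hr; apply: le_ball xx'; rewrite ler_pdivrMr// ler_peMr ?ler1n// ltW.
  have [Dy fy] : D y /\ `|f x - f y| < e / 2.
    apply: hr; rewrite [r](splitr r); apply: ball_triangle xx' _.
    by apply: le_ball x'y; exact: ltW.
  split => //; move: fx' fy; rewrite !ltr_norml => /andP[? ?] /andP[? ?].
  rewrite lerBlDr ge_max; apply/andP; split.
    by rewrite -lerBlDr le_max; apply/orP; left; lra.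
  by rewrite addr_ge0 ?(ltW e0)// le_max lexx orbT.
exists (r0 / 2); first by rewrite divr_gt0.
move=> x y Kx; apply: hr0 => //=.
  rewrite /ball/= sub0r normrN gtr0_norm ?divr_gt0//.
  by rewrite ltr_pdivrMr// ltr_pMr// ltr1n.
by rewrite divr_gt0.
Qed.

End domain.

(** * Choice of the constants and conclusion *)

Section estimate.
Context {R : realType} {d : nat}.
Local Notation V := 'rV[R]_d.
Local Notation mu := (@lebesgue_rV R d).
Local Notation m0 := (fun=> 0%N).
Variables (p delta : R).

Let pk : R := @kpeak R d.
Let W : R := (2 * `|delta|) ^+ d.
Let beta : R := d%:R / (2 * p).

(** With a = 2 pk W + 1 one has T^(-d/2) = a^(-d) <= 1/a for every d >= 1, so pk W T^(-d/2) <=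
    1/2. *)
Definition horizon : R := (2 * pk * W + 1) ^+ 2.

Local Notation T := horizon.

(** The first term is the integral of t^(-beta) over (0, T); the second is T times the constant
    added to the source, which is 2 (1 + pk) T^(-beta) per unit of norm. *)
Definition abp_const : R := (1 + pk) *
  (T `^ (1 - beta) / (1 - beta) + 2 * T * expR (- beta * ln T)).

Let W0 : 0 <= W.
Proof. by rewrite exprn_ge0// mulr_ge0. Qed.

Let pkW0 : 0 <= 2 * pk * W.
Proof. by rewrite !mulr_ge0// kpeak_ge0. Qed.

Lemma horizon_ge1 : 1 <= T.
Proof. by rewrite exprn_ege1// lerDr. Qed.

Lemma horizon_decay : (0 < d)%N -> pk * W * expR (- (d%:R / 2) * ln T) <= 1 / 2.
Proof.
move=> d0; set a := 2 * pk * W + 1.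
have a0 : 0 < a by rewrite ltr_wpDl.
apply: (@le_trans _ _ (pk * W * a^-1)); last first.
  by rewrite ler_pdivrMr// /a; lra.
apply: ler_wpM2l; first by rewrite mulr_ge0// kpeak_ge0.
rewrite -[leRHS](@lnK _ a^-1) ?posrE ?invr_gt0// ler_expR.
rewrite lnV ?posrE// /horizon -/a lnXn//.
have la0 : 0 <= ln a by rewrite ln_ge0// lerDr.
have : 1 <= d%:R :> R by rewrite ler1n.
rewrite -mulr_natl; nra.
Qed.

Hypotheses (d_gt0 : (0 < d)%N) (p_ge1 : 1 <= p) (p_gt : d%:R / 2 < p).

Let p0 : 0 < p.
Proof. exact: lt_le_trans p_ge1. Qed.

Let hbeta : 0 < beta < 1.
Proof.
have p20 : 0 < 2 * p by rewrite mulr_gt0.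
by rewrite divr_gt0 ?ltr0n//= /beta ltr_pdivrMr// mul1r mulrC -ltr_pdivrMr.
Qed.

Lemma abp_const_gt0 : 0 < abp_const.
Proof.
have /andP[_ b1] := hbeta; have T0 : 0 < T := lt_le_trans ltr01 horizon_ge1.
have h1 : 0 < 1 + pk by rewrite ltr_wpDr ?kpeak_ge0.
have h2 : 0 < T `^ (1 - beta) / (1 - beta) by rewrite divr_gt0 ?powR_gt0 ?subr_gt0.
have h3 : 0 <= 2 * T * expR (- beta * ln T).
  by rewrite mulr_ge0 ?expR_ge0// mulr_ge0// ltW.
by rewrite mulr_gt0// ltr_wpDr.
Qed.

(** The truncation makes the integrand bounded on a set of finite measure, and can only decrease the
    norm. *)
Lemma Lnorm_truncate (D : set V) (f : V -> R) (F0 N B : R) : measurable D ->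
  measurable_fun D f -> 0 <= F0 -> 0 <= N -> N <= B -> (mu D < +oo)%E ->
  ('N[mu]_(p%:E)[EFin \o (f^\+ \_ D)%R] = N%:E)%E ->
  \int[mu]_(y in D) ((Num.min (Num.max (f y) 0) F0) `^ p) <= B `^ p.
Proof.
move=> mD mf F00 N0 NB Doo hN.
have mG : measurable_fun D (fun y => Num.min (Num.max (f y) 0) F0).
  by apply: measurable_minr => //; exact: measurable_maxr.
have mGp : measurable_fun D (fun y => (Num.min (Num.max (f y) 0) F0) `^ p).
  exact: measurableT_comp (measurable_powR p) mG.
have G0 y : 0 <= Num.min (Num.max (f y) 0) F0 by rewrite le_min F00 le_max lexx orbT.
have mfD : measurable_fun [set: V] (f^\+ \_ D).
  by apply/(measurable_restrictT _ mD); exact: measurable_funrpos.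
have := poweR_Lnorm mu (EFin \o (f^\+ \_ D)%R) (lt0r_neq0 p0).
rewrite hN poweR_EFin => hNp.
apply: (@le_trans _ _ (N `^ p)); last first.
  by rewrite ge0_ler_powR ?nnegrE ?(ltW p0)// (le_trans N0).
rewrite /Rintegral -[leRHS]/(fine (N `^ p)%:E) hNp fine_le//.
- apply: integrable_fin_num => //; apply: measurable_bounded_integrable => //.
  exists (F0 `^ p); split; rewrite ?num_real// => x Fx y Dy /=.
  rewrite ger0_norm ?powR_ge0// (le_trans _ (ltW Fx))//.
  by rewrite ge0_ler_powR ?nnegrE ?(ltW p0)// ge_min lexx orbT.
- by rewrite -hNp.
rewrite integral_mkcond; apply: ge0_le_integral => //.
- move=> y _; rewrite /patch; case: ifP => //= _.
  by rewrite lee_fin powR_ge0.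
- by apply/(measurable_restrictT _ mD)/measurable_EFinP.
- have -> : (fun y => `|(EFin \o (f^\+ \_ D)%R) y| `^ p)%E =
      EFin \o (fun y => `|(f^\+ \_ D) y| `^ p).
    by apply/funext => y; rewrite /= ?poweR_EFin.
  apply/measurable_EFinP; apply: measurableT_comp (measurable_powR p) _.
  exact: measurableT_comp.
move=> y _ /=; rewrite /patch; case: ifP => yD /=; last by rewrite lee_fin powR_ge0.
rewrite lee_fin ge0_ler_powR ?nnegrE ?(ltW p0)//.
by rewrite (le_trans _ (ler_norm _))// ge_min lexx.
Qed.

Lemma abp_bound (j : V -> R) (D : set V) (f u : V -> R) (N e : R) :
  jump_kernel j -> open D -> bounded_set D -> diam D = delta ->
  {within D, continuous f} -> continuous u -> bounded_fun u ->
  viscosity_subsolution j ([set x | 0 < u x] `&` D) u (fun x => - f x) ->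
  (forall x, ~ D x -> u x <= 0) -> 0 <= N -> 0 < e ->
  ('N[mu]_(p%:E)[EFin \o (f^\+ \_ D)%R] = N%:E)%E ->
  forall x, u x <= abp_const * (N + e) + 8 * T * e + e.
Proof.
move=> hj oD bD dD cf cu bu visc uD N0 e0 hN x1.
have T1 := horizon_ge1; have T0 : 0 < T := lt_le_trans ltr01 T1.
have /andP[beta0 beta1] := hbeta.
have pk0 : 0 <= pk := kpeak_ge0.
have [x1K|x1K] := leP e (u x1); last first.
  rewrite (le_trans (ltW x1K))// lerDr addr_ge0//.
    exact: mulr_ge0 (ltW abp_const_gt0) (addr_ge0 N0 (ltW e0)).
  by rewrite mulr_ge0 ?(ltW e0)// mulr_ge0// ltW.
pose K := [set x | e <= u x].
have KD : K `<=` D.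
  move=> x /= ex; apply: contrapT => /uD; rewrite leNgt => /negP; apply.
  exact: lt_le_trans ex.
have cK : compact K.
  apply: bounded_closed_compact.
    have [M [Mr DM]] := bD; exists M; split => // r Mr' x /KD; exact: DM.
  rewrite (_ : K = u @^-1` [set r | e <= r])//.
  apply: closed_comp; last exact: closed_ge.
  by move=> z _; exact: cu.
have mD : measurable D by exact: measurable_open_rV.
have DW : (mu D <= W%:E)%E by have := volume_le oD bD; rewrite dD.
have Doo : (mu D < +oo)%E by exact: le_lt_trans DW (ltry _).
have mf : measurable_fun D f by exact: measurable_within_continuous.
have [c cKc fc] := compact_EVT_max (ex_intro _ x1 x1K) cK (continuous_subspaceW KD cf).
(* Truncation at [F0] leaves the positive part of f unchanged on K, the only place where it must be
   matched exactly. *)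
pose F0 := Num.max (f c) 0.
have F00 : 0 <= F0 by rewrite le_max lexx orbT.
have fF0 x : K x -> Num.max (f x) 0 <= F0.
  move=> Kx; rewrite ge_max [X in _ && X]F00 andbT le_max fc// inE; exact: Kx.
have [r r0 hr] := uniform_radius oD cf cK KD e0.
(* B is positive even if N = 0, as the level in [potential_ub] requires. *)
pose B := N + e; have B0 : 0 < B by rewrite ltr_wpDl.
have pB : 0 <= (1 + pk) * B by exact: mulr_ge0 (addr_ge0 ler01 pk0) (ltW B0).
pose M1 := 2 * (1 + pk) * B * expR (- beta * ln T) + 8 * e.
have M10 : 0 <= M1 by rewrite addr_ge0 ?mulr_ge0 ?expR_ge0 ?addr_ge0 ?(ltW B0) ?(ltW e0).
pose G y := Num.min (Num.max (f y) 0) F0.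
have mG : measurable_fun D G.
  by apply: measurable_minr => //; exact: measurable_maxr.
have G0 y : D y -> 0 <= G y <= F0.
  by move=> _; rewrite le_min F00 le_max lexx orbT/= ge_min lexx orbT.
have GB : \int[mu]_(y in D) (G y `^ p) <= B `^ p.
  by apply: Lnorm_truncate hN => //; rewrite lerDl ltW.
pose g y := G y + M1.
have ig : mu.-integrable D (EFin \o g) by exact: (integrable_G mD DW mG G0 M10).
have g0 y : D y -> 0 <= g y by move=> /G0/andP[G0y _]; rewrite addr_ge0.
(* The lost mass fraction d theta costs at most e on values up to F0 + M1; s is then defined by 16 s
   / r^2 = theta. *)
pose theta := Num.min 1 (e / (d%:R * (F0 + M1) + 1)).
have den0 : 0 < d%:R * (F0 + M1) + 1 by rewrite ltr_wpDl// mulr_ge0// addr_ge0.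
have th0 : 0 < theta by rewrite lt_min ltr01 divr_gt0.
pose s := theta * r ^+ 2 / 16.
have s0 : 0 < s by rewrite divr_gt0// mulr_gt0// exprn_gt0.
have thE : 16 * s / r ^+ 2 = theta by rewrite /s; field; rewrite gt_eqF.
have [A [hv ht]] := heat_potential mD ig g0 s0.
pose b t := (1 + pk) * B * expR (- beta * ln (s + t)) +
  M1 * Num.min 1 (pk * W * expR (- (d%:R / 2) * ln (s + t))).
have vb t x : 0 <= t -> 0 <= potential D g (kap m0 (s + t)) x <= b t.
  move=> t0; have st : 0 < s + t by rewrite ltr_wpDr.
  rewrite (potential_ge0 mD ig g0)//=.
  exact: (potential_ub mD DW mG G0 M10 p_ge1 B0 GB).
(* More than T/s steps, so that the step is at most s, as [sum_decay] requires. *)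
have [n [n0 [A' [w [w1 [w2 [hw wb wL]]]]]]] :=
  supersolution (Num.truncn (T / s)).+1 hj T0 e0 hv ht vb.
have n_gt0 : 0 < n%:R :> R by rewrite ltr0n (leq_trans _ n0).
have hns : T / n%:R <= s.
  rewrite ler_pdivrMr// mulrC -ler_pdivrMr//.
  by rewrite (le_trans (ltW (truncnS_gt _)))// ler_nat ltnW.
have Tn0 : 0 <= T / n%:R by rewrite divr_ge0 ?ltW.
(* Here the minimum in [b] is bounded by 1, so that M1 costs T M1; in [bT] its second member is
   used, which leaves at most M1/2 at time T. *)
have w_ub x : w x <= abp_const * B + 8 * T * e.
  have /andP[_ /le_trans] := wb x; apply.
  apply: (@le_trans _ _ (T / n%:R * \sum_(k < n)
    ((1 + pk) * B * expR (- beta * ln (s + T / n%:R * k%:R)) + M1))).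
    rewrite ler_wpM2l//; apply: ler_sum => k _; rewrite lerD2l.
    by rewrite ler_piMr// ge_min lexx.
  rewrite big_split/= -mulr_sumr sumr_const card_ord mulrDr.
  have -> : T / n%:R * (M1 *+ n) = T * M1.
    by rewrite -[M1 *+ n]mulr_natr; field; rewrite gt_eqF.
  have hs := sum_decay hbeta T0 (leq_trans (ltn0Sn _) n0) hns.
  have := ler_wpM2l pB hs.
  rewrite /abp_const /M1; lra.
have bT : b T <= (1 + pk) * B * expR (- beta * ln T) + M1 / 2.
  have lnT : ln T <= ln (s + T).
    by rewrite ler_ln ?posrE ?addr_gt0// lerDr ltW.
  rewrite /b lerD//.
    rewrite ler_wpM2l// ler_expR !mulNr lerN2.
    by rewrite ler_wpM2l// ltW.
  rewrite ler_wpM2l// -[leRHS]mul1r ge_min; apply/orP; right.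
  rewrite mul1r -[2^-1]mul1r; apply: le_trans (horizon_decay d_gt0).
  apply: ler_wpM2l; first exact: mulr_ge0.
  have d20 : 0 <= d%:R / 2 :> R by rewrite divr_ge0.
  by have := ler_wpM2l d20 lnT; rewrite ler_expR; lra.
have v0 x : K x -> Num.max (f x) 0 + M1 - 2 * e <= potential D g (kap m0 (s + 0)) x.
  move=> Kx; rewrite addr0.
  have fx0 : 0 <= Num.max (f x) 0 by rewrite le_max lexx orbT.
  set a := Num.max (f x) 0 - e + M1.
  have eM1 : 8 * e <= M1 by rewrite lerDr mulr_ge0 ?expR_ge0// -mulrA mulr_ge0.
  have a0 : 0 <= a by rewrite /a; lra.
  have aF : a <= F0 + M1 by have := fF0 _ Kx; rewrite /a; lra.
  have hb y : ball x r y -> D y /\ a <= g y.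
    move=> /(hr _ _ Kx)[Dy h]; split => //; rewrite /a /g lerD2r /G le_min h/=.
    by have := fF0 _ Kx; lra.
  have th1 : 16 * s / r ^+ 2 <= 1 by rewrite thE ge_min lexx.
  have := potential_lb mD ig g0 s0 r0 th1 a0 hb; apply: le_trans.
  rewrite thE.
  have : d%:R * theta * a <= e.
    apply: (@le_trans _ _ (d%:R * (e / (d%:R * (F0 + M1) + 1)) * (F0 + M1))).
      rewrite ler_pM ?mulr_ge0 ?(ltW th0)// ler_wpM2l//.
      by rewrite ge_min lexx orbT.
    have -> : d%:R * (e / (d%:R * (F0 + M1) + 1)) * (F0 + M1) =
      e * ((d%:R * (F0 + M1)) / (d%:R * (F0 + M1) + 1)) by ring.
    by rewrite ler_piMr ?(ltW e0)// ler_pdivrMr// mul1r lerDl.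
  rewrite /a; lra.
have := comparison hj oD cu bu visc uD e0 cK hw (fun x => proj1 (andP (wb x))).
move=> /(_ _ x1)/le_trans; apply; last by rewrite lerD2r.
move=> x Kx; apply: le_lt_trans (wL x) _.
have := v0 x Kx; have : f x <= Num.max (f x) 0 by rewrite le_max lexx.
have : M1 = 2 * (1 + pk) * B * expR (- beta * ln T) + 8 * e by [].
lra.
Qed.

End estimate.

Theorem theorem1p3 (R : realType) (d : nat) (d_gt0 : (0 < d)%N)
    (p : R) (p_ge1 : 1 <= p) (p_gt : d%:R / 2 < p) (delta : R) :
  exists2 C : R, 0 < C &
    forall (j : 'rV[R]_d -> R) (D : set 'rV[R]_d) (f u : 'rV[R]_d -> R),
      jump_kernel j ->
      condition_A1 j ->
      open D -> bounded_set D -> diam D = delta ->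
      {within D, continuous f} ->
      continuous u -> bounded_fun u ->
      viscosity_subsolution j ([set x | 0 < u x] `&` D) u (fun x => - f x) ->
      (forall x, ~ D x -> u x <= 0) ->
      (ereal_sup [set (u x)%:E | x in D] <=
       C%:E * 'N[lebesgue_rV d]_(p%:E)[EFin \o (f^\+ \_ D)%R])%E.
Proof.
exists (@abp_const R d p delta); first exact: abp_const_gt0.
move=> j D f u hj _ oD bD dD cf cu bu visc uD.
apply: ge_ereal_sup => _ [x Dx <-].
set N := Lnorm _ _ _.
have N0 : (0 <= N)%E by exact: Lnorm_ge0.
have C0 : 0 < @abp_const R d p delta by exact: abp_const_gt0.
case hN : N N0 => [N'| |] //= N0; last by rewrite gt0_muley ?leey ?lte_fin.
rewrite -EFinM lee_fin; apply/ler_addgt0Pr => e e0.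
set C := @abp_const R d p delta in C0 *; set T := @horizon R d delta.
have T0 : 0 < T by exact: lt_le_trans ltr01 (horizon_ge1 _).
have c0 : 0 < C + 8 * T + 1 by rewrite addr_gt0// addr_gt0// mulr_gt0.
(* The errors C e' + 8 T e' + e' of [abp_bound] then add up to e. *)
pose e' := e / (C + 8 * T + 1).
have e'0 : 0 < e' by rewrite divr_gt0.
have := abp_bound d_gt0 p_ge1 p_gt hj oD bD dD cf cu bu visc uD N0 e'0 hN x.
move=> /le_trans; apply.
rewrite -/C -/T.
have : e' * (C + 8 * T + 1) = e by rewrite divfK// gt_eqF.
lra.
Qed.
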